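(* Let $X_t=x_0+\mu t+\sigma W_t$ with $x_0,\mu\in\mathbb{R}$, $\sigma>0$, let $a>0$, and let $N_t^a=\sum_{n=1}^\infty 1_{\{\tau_a^n\le t\}}$ be the number of drawdowns without recovery observed by time $t$. Then, with probability one, $$\lim_{t\to\infty}\frac{N_t^a}{t}=\frac{1}{\mathbb{E}[\tau_a^1]}=\frac{2\mu^2}{\sigma^2e^{2\mu a/\sigma^2}-\sigma^2-2\mu a},$$ where for $\mu=0$ the right-hand side is understood as its limit $\sigma^2/a^2$ as $\mu\to0$.
   Context: $W$ is a standard Brownian motion; $a>0$ is fixed; $M_{[s,t]}=\sup_{s\le u\le t}X_u$; $\inf\emptyset=\infty$. The drawdown times without recovery are defined by $\tau_a^0=0$ and, for $n\ge1$, $$\tau_a^n=\inf\{t>\tau_a^{n-1}:\ M_{[\tau_a^{n-1},t]}-X_t\ge a\}.$$ *)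

(* Defs.v *)
From HB Require Import structures.
From mathcomp Require Import all_boot all_order all_algebra.
From mathcomp Require Import all_classical all_reals all_analysis.

Set Implicit Arguments.
Unset Strict Implicit.
Unset Printing Implicit Defensive.

Import Order.TTheory GRing.Theory Num.Theory.
Import numFieldNormedType.Exports.

Local Open Scope classical_set_scope.
Local Open Scope ring_scope.

(* The product rule for subfamilies is included: take A i = setT for the
   indices to be left out. *)
Definition mutually_independent (R : realType) (d : measure_display)
    (T : measurableType d) (P : probability T R) (n : nat)
    (Y : 'I_n -> T -> R) : Prop :=
  forall A : 'I_n -> set R, (forall i, measurable (A i)) ->
    P (\bigcap_(i in [set: 'I_n]) (Y i @^-1` A i)) =
    (\prod_(i < n) P (Y i @^-1` A i))%E.

(* The process is indexed by all of R for convenience, but only the times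
   t >= 0 are constrained.  The second parameter of normal_prob is the standard
   deviation.  A finite list of times t_0 <= ... <= t_n is given as the
   beginning of a nondecreasing sequence. *)
Record standard_brownian_motion (R : realType) (d : measure_display)
    (T : measurableType d) (P : probability T R)
    (W : R -> {RV P >-> R}) : Prop := {
  brownian_start : {ae P, forall w, W 0 w = 0};
  brownian_continuous :
    {ae P, forall w, {within `[0, +oo[, continuous (fun t : R => W t w)}};
  brownian_gaussian : forall s t : R, 0 <= s -> s < t ->
    forall A : set R, measurable A ->
      P ((fun w => W t w - W s w) @^-1` A) =
      normal_prob 0 (Num.sqrt (t - s)) A;
  brownian_independent : forall (n : nat) (t : nat -> R),
    0 <= t 0%N -> nondecreasing_seq t ->
    mutually_independent P
      (fun (i : 'I_n) w => W (t i.+1) w - W (t i) w) }.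

(* M_[s, t] of a path x; s may be infinite because it will be a drawdown
   time. *)
Definition running_sup (R : realType) (x : R -> R) (s : \bar R) (t : R)
    : \bar R :=
  ereal_sup [set (x u)%:E | u in [set u : R | (s <= u%:E <= t%:E)%E]].

Fixpoint drawdown_time (R : realType) (a : R) (x : R -> R) (n : nat)
    : \bar R :=
  if n is m.+1 then
    ereal_inf [set t%:E | t in [set t : R |
      (drawdown_time a x m < t%:E)%E /\
      (a%:E <= running_sup x (drawdown_time a x m) t - (x t)%:E)%E]]
  else 0%E.

Definition drawdown_count (R : realType) (a : R) (x : R -> R) (t : R)
    : \bar R :=
  (\sum_(1 <= n <oo) ((drawdown_time a x n <= t%:E)%E)%:R%:E)%E.

Definition drifted_path (R : realType) (x0 mu sigma : R) (b : R -> R) (t : R)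
    : R :=
  x0 + mu * t + sigma * b t.

(* At mu = 0 this is a division by zero; see drawdown_rate. *)
Definition drawdown_rate_formula (R : realType) (sigma a mu : R) : R :=
  2 * mu ^+ 2 /
  (sigma ^+ 2 * expR (2 * mu * a / sigma ^+ 2) - sigma ^+ 2 - 2 * mu * a).

Definition drawdown_rate (R : realType) (sigma a mu : R) : R :=
  if mu == 0 then sigma ^+ 2 / a ^+ 2 else drawdown_rate_formula sigma a mu.

(* Main.v *)
Require Import Defs.
From HB Require Import structures.
From mathcomp Require Import all_boot all_order all_algebra.
From mathcomp Require Import all_classical all_reals all_analysis.
From mathcomp Require Import measurable_realfun ring lra.

Set Implicit Arguments.
Unset Strict Implicit.
Unset Printing Implicit Defensive.

Import Order.TTheory GRing.Theory Num.Theory.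
Import numFieldNormedType.Exports.

Local Open Scope classical_set_scope.
Local Open Scope ring_scope.

(** Let f solve (sigma^2 / 2) f'' - mu f' = 1 with f(0) = 0 and f'(0) = delta, and
    let Y be the drawdown of X since the last counted one, restarted from 0 when
    it reaches a.  For delta = 0 the process f(a) N_t + f(Y_t) - t is a martingale
    whose variance grows at most linearly; as f(Y) is bounded, Chebyshev and
    Borel-Cantelli along the times i^2, together with the monotonicity of N, give
    N_t / t -> 1 / f(a), and stopping at the first drawdown gives
    E[tau_a^1] = f(a).  Neither the strong Markov property nor a law of large
    numbers for the durations is needed.

    Stochastic calculus is avoided by sampling X on a grid of mesh h.  The
    increment X_h satisfies E f(y - X_h) = f(y) + h exactly, so the sum of the
    f(Y_j - xi_j) - f(Y_j) - h over the sampled chain is a martingale with no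
    discretization error.  It differs from the increment of f(a) N + f(Y) - t only
    through the reflection of Y at 0 and the overshoot at a, and these differences
    have a sign: one sign for delta = 0, the other for delta > 0 as soon as all
    increments are small.  A grid count is at most the true count, and for a
    continuous path the true count at level a is at most the grid count at any
    level b < a once the grid is fine enough. *)

(** Between counts Y moves like -X, whose generator is (sigma^2 / 2) f'' - mu f', and f'(0) = 0 is
    the Neumann condition of reflection at 0. A grid step can jump to some z < 0 before it is put
    back to 0: this lowers f when f >= 0 and raises it when f <= 0 just left of 0, which a slope
    delta > 0 enforces. Each of the two bounds is therefore proved for a constant slightly off f(a):
    the slack pays for a level b < a in one, for delta and the overshoot in the other.

    Two limits compete, the horizon m tending to infinity and the mesh tending to 0. The variance is
    O(m) uniformly in the mesh, whereas the path comparisons hold below a mesh that depends on the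
    path. Borel-Cantelli is thus applied to the event that the sum is large for all fine meshes;
    outside it the sum is small for infinitely many meshes, and one of these is fine enough. No
    limit of the martingales as the mesh shrinks is taken.

    For the mean, the first grid drawdown is capped at m, so that no integrability of the first
    drawdown time has to be known beforehand. *)

Lemma within_continuous_unif (R : realType) (x : R -> R) (m e : R) :
  {within `[0, +oo[, continuous x} -> 0 < e ->
  exists2 d : R, 0 < d & forall u v : R, 0 <= u <= m -> 0 <= v <= m ->
    `|u - v| < d -> `|x u - x v| < e.
Proof.
move=> cx e0.
(* The condition [0 <= u <= m] is part of [P] because the covering form of compactness asks for [P]
   at all [u] near a point of the segment, also at those outside it. *)
pose P (d u : R) := 0 <= u <= m -> forall v : R, 0 <= v <= m ->
  `|u - v| < d -> `|x u - x v| < e.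
have loc (t : R) : 0 <= t -> exists2 d : R, 0 < d &
    forall u, 0 <= u -> `|t - u| < d -> `|x t - x u| < e / 2.
  move=> t0.
  have e20 : 0 < e / 2 by rewrite divr_gt0.
  have tI : [set` `[0 : R, +oo[] t by rewrite /= in_itv/= t0.
  have /subspace_continuousP/(_ t tI)/cvgrPdist_lt/(_ _ e20) := cx.
  move=> /nbhs_ballP[d /= d0 dP].
  exists d => // u u0 tu; apply: (dP u) => //.
  by rewrite /= in_itv/= u0.
have := @segment_compact R 0 m.
move=> /compact_near_coveringP/(_ R (0:R)^'+ P _).
have H (t : R) : [set` `[0, m]] t -> \forall x' \near t & i \near 0^'+, P i x'.
  rewrite /= in_itv/= => /andP[t0 tm].
  have [d d0 dP] := loc t t0.
  have d20 : 0 < d / 2 by rewrite divr_gt0.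
  exists (ball t (d/2), [set i : R | i < d / 2]) => /=.
    split; first exact: nbhsx_ballx.
    by apply: nbhs_right_lt.
  move=> [u i] /= [tu id] /andP[u0 um] v /andP[v0 vm] uv.
  have uu : `|t - u| < d by rewrite (lt_trans tu)// ltr_pdivrMr// mulr_natr mulr2n ltrDl.
  have vv : `|t - v| < d.
    rewrite (_ : t - v = (t - u) + (u - v)); last by rewrite addrA subrK.
    rewrite (le_lt_trans (ler_normD _ _))// (splitr d) ltrD// (lt_trans uv)//.
  rewrite (_ : x u - x v = (x t - x v) - (x t - x u)); last by ring.
  rewrite (le_lt_trans (ler_normB _ _))// (splitr e) ltrD//; exact: dP.
move=> /(_ H) /= hh.
have [d [d0 dP]] : exists d : R, 0 < d /\ [set` `[0, m]] `<=` P d.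
  have : \forall d \near 0^'+, 0 < d /\ [set` `[0, m]] `<=` P d.
    near=> d; split; first by near: d; exact: nbhs_right_gt.
    by near: d; apply: hh.
  by move=> /filter_ex.
exists d => // u v um vm; apply: dP => //=; by rewrite in_itv.
Unshelve. all: by end_near. Qed.

(** * Drawdowns sampled on a grid *)

(* The state is the drawdown since the last counted one, together with the
   number of drawdowns counted so far; x is the next increment of the path. *)
Definition drawdown_step (R : realType) (b : R) (s : R * nat) (x : R) : R * nat :=
  if b <= s.1 - x then (0, s.2.+1) else (Num.max (s.1 - x) 0, s.2).

Fixpoint drawdown_chain (R : realType) (b : R) (xi : nat -> R) (n : nat) : R * nat :=
  if n is m.+1 then drawdown_step b (drawdown_chain b xi m) (xi m) else (0, 0%N).

Definition grid_increment (R : realType) (x : R -> R) (h : R) (j : nat) : R :=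
  x (j.+1%:R * h) - x (j%:R * h).

Section chain_theory.
Variables (R : realType) (b : R) (xi : nat -> R).
Hypothesis b0 : 0 < b.
Notation Y n := (drawdown_chain b xi n).1.
Notation N n := (drawdown_chain b xi n).2.

Lemma drawdown_chain_bounds n : 0 <= Y n < b.
Proof.
elim: n => [|n ih] /=; first by rewrite lexx.
rewrite /drawdown_step; case: (leP b (Y n - xi n)) => h /=; first by rewrite lexx.
by rewrite le_max lexx orbT gt_max h b0.
Qed.

Lemma drawdown_chain_count_homo i j : (i <= j)%N -> (N i <= N j)%N.
Proof.
move=> /subnK <-; elim: (j - i)%N => [|k ih] //.
by rewrite (leq_trans ih)// addSn /= /drawdown_step; case: ifP.
Qed.

End chain_theory.

Section chain_of_path.
Variables (R : realType) (x : R -> R) (b h : R).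
Hypotheses (b0 : 0 < b) (h0 : 0 < h).
Notation xi := (grid_increment x h).
Notation Y n := (drawdown_chain b xi n).1.
Notation N n := (drawdown_chain b xi n).2.
Notation tau := (drawdown_time b x).

(** As long as the true time precedes the last grid reset, the true running supremum dominates the
    grid maximum, so a drawdown seen on the grid has already been seen by the path. Hence the grid
    never counts too many. *)
Lemma drawdown_time_chain_le n : (tau (N n) <= (n%:R * h)%:E)%E.
Proof.
(* Invariant: [r] is the grid index of the last reset, and [i] one where the grid maximum since then
   is attained. *)
suff [r rn [i /andP[ri inn] [tr Yi]]] : exists2 r : nat, (r <= n)%N &
    exists2 i : nat, (r <= i <= n)%N &
    (tau (N n) <= (r%:R * h)%:E)%E /\ Y n = x (i%:R * h) - x (n%:R * h).
  by rewrite (le_trans tr)// lee_fin ler_pM2r// ler_nat.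
elim: n => [|n [r rn [i /andP[ri inn] [tr Yi]]]] /=.
  exists 0%N => //; exists 0%N => //; split; last by rewrite subrr.
  by rewrite mul0r.
have zE : Y n - xi n = x (i%:R * h) - x (n.+1%:R * h).
  by rewrite Yi /grid_increment; ring.
rewrite /drawdown_step; case: (leP b (Y _ - _)) => hz /=.
  exists n.+1 => //; exists n.+1; first by rewrite leqnn.
  split; last by rewrite subrr.
  apply: ereal_inf_lbound => /=; exists (n.+1%:R * h) => //; split.
    by rewrite (le_lt_trans tr)// lte_fin ltr_pM2r// ltr_nat ltnS.
  have : ((x (i%:R * h))%:E <= running_sup x (tau (N n)) (n.+1%:R * h))%E.
    apply: ereal_sup_ubound => /=; exists (i%:R * h) => //=.
    rewrite (le_trans tr) /= ?lee_fin ?ler_pM2r ?ler_nat//.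
    by rewrite (leq_trans inn).
  move=> /(leeD2r (- (x (n.+1%:R * h)))%:E).
  by rewrite -EFinD -zE; apply: le_trans; rewrite lee_fin.
case: (leP 0 (Y n - xi n)) => hz0.
  exists r; first by rewrite (leq_trans rn).
  exists i; first by rewrite ri (leq_trans inn).
  by split => //; rewrite max_l.
exists r; first by rewrite (leq_trans rn).
exists n.+1; first by rewrite leqnn (leq_trans rn).
by split => //; rewrite subrr.
Qed.

(** Without a count [Y] moves by minus the increment of the path, and the reflection at 0 only
    raises it. It is used in the contrapositive: as [Y j < b], a drop of at least [b] between two
    grid times forces a count. *)
Lemma drawdown_chain_greedy i j : (i <= j)%N ->
  (N i < N j)%N \/ x (i%:R * h) - x (j%:R * h) <= Y j.
Proof.
move=> /subnK <-; elim: (j - i)%N => [|k ih].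
  by right; rewrite add0n subrr; have /andP[] := drawdown_chain_bounds xi b0 i.
rewrite addSn /= /drawdown_step; case: leP => hz /=.
  left; case: ih => [/ltnW|] ih; first by rewrite ltnS.
  by rewrite ltnS drawdown_chain_count_homo// leq_addl.
case: ih => ih; [by left|right]; rewrite le_max; apply/orP; left.
rewrite [leRHS](_ : _ = Y (k + i) + (x ((k + i)%:R * h) - x ((k + i).+1%:R * h))).
  by lra.
by rewrite /grid_increment; ring.
Qed.

End chain_of_path.

(** * True drawdown times of a continuous path against grid counts *)

Section drawdown_time_theory.
Variables (R : realType) (x : R -> R) (a : R).
Notation tau := (drawdown_time a x).

Lemma drawdown_time_le_succ n : (tau n <= tau n.+1)%E.
Proof. by apply: le_ereal_inf_tmp => _ /= [t [nt _] <-]; exact: ltW. Qed.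

Lemma drawdown_time_homo : {homo tau : m n / (m <= n)%N >-> (m <= n)%E}.
Proof.
move=> m n /subnK <-; elim: (n - m)%N => [|k ih] //.
exact: (le_trans ih (drawdown_time_le_succ _)).
Qed.

Lemma drawdown_time_ge0 n : (0 <= tau n)%E.
Proof. exact: (drawdown_time_homo (leq0n n)). Qed.

(** Giving up a little height, [c < a], makes near-optimal points sufficient: it is never shown that
    the infimum or the supremum is attained. *)
Lemma drawdown_time_attained n (t c : R) : {within `[0, +oo[, continuous x} ->
  tau n.+1 = t%:E -> 0 <= c < a ->
  exists s : R, [/\ (tau n <= s%:E)%E, s <= t & c < x s - x t].
Proof.
move=> cx taut /andP[c0 ca].
have t0 : 0 <= t by rewrite -lee_fin -taut drawdown_time_ge0.
(* One third is lost in approximating the running supremum at [t'], one third in replacing [t'] by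
   [t], and one third remains for strictness. *)
have e0 : 0 < (a - c) / 3 by rewrite divr_gt0 ?subr_gt0.
have [d d0 dP] := within_continuous_unif (t + 1) cx e0.
have : (tau n.+1 < (t + Num.min d 1)%:E)%E.
  by rewrite taut lte_fin ltrDl lt_min d0/= ltr01.
move=> /ereal_inf_lt[_ [t' [nt' at'] <-]]; rewrite lte_fin => t't.
have tt' : t <= t'.
  by rewrite -lee_fin -taut; apply: ereal_inf_lbound => /=; exists t'.
have t'd : t' < t + d by rewrite (lt_le_trans t't)// lerD2l ge_min lexx.
have t'1 : t' < t + 1 by rewrite (lt_le_trans t't)// lerD2l ge_min lexx orbT.
have : ((a + x t' - (a - c) / 3)%:E < running_sup x (tau n) t')%E.
  rewrite (@lt_le_trans _ _ (a + x t')%:E)//; first by rewrite lte_fin gtrBl.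
  move: at'; case: (running_sup _ _ _) => [r|_|]//; last by rewrite leey.
  by rewrite -EFinB !lee_fin lerBrDr.
move=> /ereal_sup_gt[_ /= [s /= /andP[ns st'] <-]]; rewrite lte_fin => xs.
have s0 : 0 <= s by rewrite -lee_fin (le_trans _ ns)// drawdown_time_ge0.
rewrite lee_fin in st'.
(* If [t < s], then [s] and [t'] are within [d] of each other and the drop between them is below
   [(a - c) / 3], although it exceeds [c + 2 * (a - c) / 3]. *)
case: (leP s t) => st.
  exists s; split => //.
  have := dP t t'; rewrite t0/= lerDl ler01 (le_trans t0 tt') (ltW t'1).
  have td : `|t - t'| < d.
    by clear -tt' t'd d0; rewrite ltr_norml; apply/andP; split; lra.
  move=> /(_ isT isT td); rewrite ltr_norml => /andP[].
  by clear -xs ca; lra.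
have := dP s t'; rewrite s0 (le_trans s0 st') (ltW t'1)/=.
have sd : `|s - t'| < d.
  by clear -st st' t'd d0; rewrite ltr_norml; apply/andP; split; lra.
rewrite (le_trans st' (ltW t'1)) => /(_ isT isT sd).
by rewrite ltr_norml => /andP[_]; clear -xs c0 ca; lra.
Qed.

(** Induction on [n]: between [s], not before the [n]-th time, and [t] the path drops by more than
    [(a + b) / 2]. Rounding both times down to the grid costs at most [(a - b) / 4] each, which
    leaves a grid drop above [b] and hence one more count. The threshold [d] depends on the horizon
    [m] but not on [n]. *)
Lemma drawdown_chain_count_ge (b m : R) : {within `[0, +oo[, continuous x} ->
  0 < b < a -> exists2 d : R, 0 < d & forall h : R, 0 < h < d ->
  forall (n : nat) (t : R), tau n = t%:E -> t <= m ->
  (n <= (drawdown_chain b (grid_increment x h) (Num.truncn (t / h))).2)%N.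
Proof.
move=> cx /andP[b0 ba].
have e0 : 0 < (a - b) / 4 by rewrite divr_gt0 ?subr_gt0.
have [d d0 dP] := within_continuous_unif m cx e0.
exists d => // h /andP[h0 hd]; elim=> [//|n ih] t taut tm.
have cE : 0 <= (a + b) / 2 < a by clear -b0 ba; apply/andP; split; lra.
have [s [ns st xst]] := drawdown_time_attained cx taut cE.
have [t' taut'] : exists t', tau n = t'%:E.
  move: ns (drawdown_time_ge0 n); case: (tau n) => [r|//|//] _ _; by exists r.
have t'0 : 0 <= t' by rewrite -lee_fin -taut' drawdown_time_ge0.
rewrite taut' lee_fin in ns.
have s0 : 0 <= s := le_trans t'0 ns.
have t0 : 0 <= t := le_trans s0 st.
have ns' : (n <= (drawdown_chain b (grid_increment x h) (Num.truncn (s / h))).2)%N.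
  rewrite (leq_trans (ih _ taut' (le_trans ns (le_trans st tm))))//.
  by apply: drawdown_chain_count_homo; rewrite le_truncn// ler_pM2r ?invr_gt0.
have fl (u : R) : 0 <= u -> u <= m -> 
    `|x ((Num.truncn (u / h))%:R * h) - x u| < (a - b) / 4.
  move=> u0 um.
  have uh0 : 0 <= u / h by rewrite divr_ge0 // ltW.
  have /andP[l1 l2] := truncn_itv uh0.
  rewrite ler_pdivlMr// in l1; rewrite ltr_pdivrMr// in l2.
  apply: dP; rewrite ?mulr_ge0 ?(ltW h0) ?u0//=.
    exact: le_trans l1 um.
  rewrite ler0_norm ?subr_le0// opprB (lt_trans _ hd)//.
  by move: l2; rewrite -natr1 mulrDl mul1r ltrBlDl.
have ij : (Num.truncn (s / h) <= Num.truncn (t / h))%N.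
  by apply: le_truncn; rewrite ler_pM2r ?invr_gt0.
case: (drawdown_chain_greedy x h b0 ij) => [ltN|geY].
  exact: leq_ltn_trans ltN.
have /andP[_ Yb] := drawdown_chain_bounds (grid_increment x h) b0 (Num.truncn (t / h)).
have := fl _ s0 (le_trans st tm); have := fl _ t0 tm.
rewrite !ltr_norml => /andP[_ h1] /andP[h2 _].
by exfalso; clear -h1 h2 geY Yb xst; lra.
Qed.

End drawdown_time_theory.

(** * The martingale inequality along a single path *)

Section compensated_sums.
Variables (R : realType) (b h : R) (xi : nat -> R) (f : R -> R) (w : nat -> R) (c : R).
Notation Y n := (drawdown_chain b xi n).1.
Notation N n := (drawdown_chain b xi n).2.

(** The weight looks only at the count before the step, so weighted sums of centered increments stay
    martingales. *)
Definition compensated_increment (s : R * nat) (x : R) : R :=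
  w s.2 * (f (s.1 - x) - f s.1 - h).

(* With w = 1 this is c N + f(Y); with w the indicator of 0 it is the same process
   stopped at the first drawdown. *)
Definition chain_potential (s : R * nat) : R :=
  c * (\sum_(i < s.2) w i) + w s.2 * f s.1.

Hypotheses (b0 : 0 < b) (w0 : forall n, 0 <= w n) (f0 : f 0 = 0).

(** Step by step: a count replaces [f z] by [c <= f z], and a reflection replaces [f z >= 0] by
    [f 0 = 0]. The weight changes only at a count, when the state is 0, and there [f 0 = 0] hides
    the change. *)
Lemma compensated_sum_ge n : (forall z, 0 <= f z) -> (forall z, b <= z -> c <= f z) ->
  chain_potential (drawdown_chain b xi n) - h * (\sum_(j < n) w (N j)) <=
  \sum_(j < n) compensated_increment (drawdown_chain b xi j) (xi j).
Proof.
move=> fge0 fc; elim: n => [|n ih].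
  by rewrite !big_ord0 /chain_potential/= big_ord0 f0 !mulr0 addr0 subr0.
rewrite !big_ord_recr /= /compensated_increment.
suff : chain_potential (drawdown_step b (drawdown_chain b xi n) (xi n)) -
    chain_potential (drawdown_chain b xi n) <=
    w (N n) * (f (Y n - xi n) - f (Y n)).
  by move: ih; rewrite /compensated_increment; lra.
rewrite /drawdown_step /chain_potential; set z := Y n - xi n.
case: (leP b z) => bz /=.
  rewrite big_ord_recr/= f0 mulr0 addr0.
  by have := ler_wpM2l (w0 (N n)) (fc _ bz); lra.
have fz : f (Num.max z 0) <= f z by case: (leP z 0) => z0; rewrite ?f0 ?fge0.
by have := ler_wpM2l (w0 (N n)) fz; lra.
Qed.

(** Both replacements now go the other way. Increments of size at most [eta] confine the value
    before correction to [[- eta, b + eta]], the only region where the signs of [f] and [f - c] are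
    under control. *)
Lemma compensated_sum_le n (eta : R) : (forall z, - eta <= z <= 0 -> f z <= 0) ->
  (forall z, b <= z <= b + eta -> f z <= c) ->
  (forall j, (j < n)%N -> `|xi j| <= eta) ->
  \sum_(j < n) compensated_increment (drawdown_chain b xi j) (xi j) <=
  chain_potential (drawdown_chain b xi n) - h * (\sum_(j < n) w (N j)).
Proof.
move=> fle0 fc; elim: n => [|n ih] xin.
  by rewrite !big_ord0 /chain_potential/= big_ord0 f0 !mulr0 addr0 subr0.
have {}ih := ih (fun j jn => xin j (ltnW jn)).
have := xin n (ltnSn n); rewrite ler_norml => /andP[x1 x2].
have /andP[Y0 Yb] := drawdown_chain_bounds xi b0 n.
rewrite !big_ord_recr /= /compensated_increment.
suff : w (N n) * (f (Y n - xi n) - f (Y n)) <=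
    chain_potential (drawdown_step b (drawdown_chain b xi n) (xi n)) -
    chain_potential (drawdown_chain b xi n).
  by move: ih; rewrite /compensated_increment; lra.
rewrite /drawdown_step /chain_potential; set z := Y n - xi n.
have zge : - eta <= z by rewrite /z; lra.
have zle : z <= b + eta by rewrite /z; lra.
case: (leP b z) => bz /=.
  rewrite big_ord_recr/= f0 mulr0 addr0.
  have fcz : f z <= c by rewrite fc// bz.
  by have := ler_wpM2l (w0 (N n)) fcz; lra.
have fz : f z <= f (Num.max z 0).
  by case: (leP z 0) => z0; rewrite ?f0// fle0// z0 andbT.
by have := ler_wpM2l (w0 (N n)) fz; lra.
Qed.

End compensated_sums.

Section chain_first_time.
Variables (R : realType) (x : R -> R) (b h : R).
Hypotheses (b0 : 0 < b) (h0 : 0 < h).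
Notation xi := (grid_increment x h).
Notation N n := (drawdown_chain b xi n).2.

(* The first grid time at which a drawdown has been counted, capped at n h. *)
Definition chain_first_time (xi : nat -> R) (n : nat) : R :=
  h * \sum_(j < n) ((drawdown_chain b xi j).2 == 0%N)%:R.

Lemma chain_first_time_ge0 (zeta : nat -> R) n : 0 <= chain_first_time zeta n.
Proof. by rewrite mulr_ge0 ?(ltW h0)// sumr_ge0. Qed.

Lemma chain_first_time_le (zeta : nat -> R) n : chain_first_time zeta n <= n%:R * h.
Proof.
rewrite /chain_first_time mulrC ler_pM2r//.
rewrite (@le_trans _ _ (\sum_(j < n) 1))//; last by rewrite sumr_const card_ord.
by apply: ler_sum => i _; case: eqP.
Qed.

Lemma chain_first_time_eq (zeta : nat -> R) n : (drawdown_chain b zeta n).2 = 0%N ->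
  chain_first_time zeta n = n%:R * h.
Proof.
move=> N0; rewrite /chain_first_time mulrC; congr (_ * h).
rewrite (eq_bigr (fun=> 1)) => [|i _]; first by rewrite sumr_const card_ord.
suff -> : (drawdown_chain b zeta i).2 = 0%N by rewrite eqxx.
apply/eqP; rewrite -leqn0 -N0.
by apply: drawdown_chain_count_homo; exact: ltnW.
Qed.

Lemma chain_first_time_le_hit (zeta : nat -> R) n i : (0 < (drawdown_chain b zeta i).2)%N ->
  chain_first_time zeta n <= i%:R * h.
Proof.
move=> Ni; case: (leqP n i) => [ni|/ltnW lin].
  rewrite (le_trans (chain_first_time_le _ _))// ler_pM2r// ler_nat//.
rewrite (le_trans _ (chain_first_time_le zeta i))// /chain_first_time.
rewrite ler_pM2l// -(subnK lin); elim: (n - i)%N => [|k ih] //.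
rewrite addSn big_ord_recr/= (_ : (_ == 0%N) = false) ?addr0//.
by rewrite gtn_eqF// (leq_trans Ni)// drawdown_chain_count_homo ?leq_addl.
Qed.

Lemma drawdown_time1_le_first_time n : (0 < N n)%N ->
  (drawdown_time b x 1 <= (chain_first_time xi n)%:E)%E.
Proof.
elim: n => [//|n ih] Nn.
case: (posnP (N n)) => [N0|N1].
  have -> : chain_first_time xi n.+1 = n.+1%:R * h.
    rewrite /chain_first_time big_ord_recr/= N0 eqxx mulrDr mulr1 -[_ * _]/(chain_first_time xi n).
    by rewrite chain_first_time_eq// -natr1 mulrDl mul1r.
  by rewrite (le_trans _ (drawdown_time_chain_le x b h0 n.+1))//; exact: drawdown_time_homo.
rewrite (le_trans (ih N1))// lee_fin ler_pM2l// big_ord_recr/= lerDl//.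
Qed.

End chain_first_time.

(** * Sums driven by independent increments *)

Definition independent_pair d d1 d2 (T : measurableType d) (T1 : measurableType d1)
    (T2 : measurableType d2) (R : realType) (P : probability T R)
    (X : T -> T1) (Y : T -> T2) : Prop :=
  forall A B, measurable A -> measurable B ->
    P (X @^-1` A `&` Y @^-1` B) = (P (X @^-1` A) * P (Y @^-1` B))%E.

Section independent_pair_theory.
Context d d1 d2 (T : measurableType d) (T1 : measurableType d1)
  (T2 : measurableType d2) (R : realType) (P : probability T R).
Variables (X : T -> T1) (Y : T -> T2).
Hypotheses (mX : measurable_fun setT X) (mY : measurable_fun setT Y).
Hypothesis XY : independent_pair P X Y.
Local Open Scope ereal_scope.

Let X' : {mfun T >-> T1} := mfun_Sub (mem_set mX).
Let Y' : {mfun T >-> T2} := mfun_Sub (mem_set mY).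
Let mXY : measurable_fun setT (fun w => (X w, Y w)).
Proof. exact: measurable_fun_pair. Qed.
Let XY' : {mfun T >-> (T1 * T2)%type} := mfun_Sub (mem_set mXY).

Let joint_law C : measurable C ->
  (distribution P X' \x distribution P Y') C = distribution P XY' C.
Proof. by apply: product_measure_unique => A B mA mB; exact: XY. Qed.

Lemma ge0_integral_independent (g : T1 * T2 -> \bar R) :
  measurable_fun setT g -> (forall z, 0 <= g z) ->
  \int[P]_w g (X w, Y w) = \int[P]_w \int[P]_w' g (X w, Y w').
Proof.
move=> mg g0.
have mF := @measurable_fun_fubini_tonelli_F _ _ _ _ _ (distribution P Y') g mg g0.
transitivity (\int[distribution P XY']_z g z).
  by rewrite ge0_integral_distribution.
transitivity (\int[distribution P X' \x distribution P Y']_z g z).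
  by apply: eq_measure_integral => C mC _; exact: esym (joint_law mC).
rewrite fubini_tonelli1// ge0_integral_distribution//; last first.
  by move=> x; exact: integral_ge0.
apply: eq_integral => w _ /=; rewrite /fubini_F ge0_integral_distribution//.
exact: measurable_fun_pair2.
Qed.

(** Freezing the first argument: under the product law the inner integral of Fubini vanishes
    identically. This is the martingale property without conditional expectations. *)
Lemma integral_independent_centered (g : T1 * T2 -> R) :
  measurable_fun setT g -> P.-integrable setT (fun w => (g (X w, Y w))%:E) ->
  (forall x, P.-integrable setT (fun w => (g (x, Y w))%:E)) ->
  (forall x, \int[P]_w (g (x, Y w))%:E = 0) ->
  \int[P]_w (g (X w, Y w))%:E = 0.
Proof.
move=> mg ig igx g0.
have mEg : measurable_fun setT (EFin \o g) by exact/measurable_EFinP.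
transitivity (\int[distribution P XY']_z (g z)%:E).
  by rewrite (@integral_distribution _ _ _ _ _ _ XY' (EFin \o g)).
transitivity (\int[distribution P X' \x distribution P Y']_z (g z)%:E).
  by apply: eq_measure_integral => C mC _; exact: esym (joint_law mC).
rewrite -(@integral12_prod_meas1 _ _ _ _ _ _ _ (EFin \o g))//; last first.
  apply/integrableP; split => //.
  rewrite (_ : \int[_]_z _ = \int[distribution P XY']_z `|(g z)%:E|); last first.
    by apply: eq_measure_integral => C mC _; exact: joint_law.
  rewrite (@ge0_integral_distribution _ _ _ _ _ _ XY' (abse \o (EFin \o g)))//.
    by move/integrableP : ig => [].
    by apply: measurableT_comp => //.
  by move=> y /=.
apply: integral0_eq => x _; rewrite /fubini_F.
rewrite (@integral_distribution _ _ _ _ _ _ Y' (fun y => (g (x, y))%:E)).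
- exact: g0.
- exact: (@measurable_fun_pair2 _ _ _ _ _ _ (EFin \o g) x mEg).
- exact: igx.
Qed.

End independent_pair_theory.

Section driven_chain.
Context d d' (T : measurableType d) (S : measurableType d') (R : realType)
  (P : probability T R).
Variables (Phi : S * R -> S) (s0 : S) (xi : nat -> T -> R).

Fixpoint driven_chain (n : nat) (w : T) : S :=
  if n is m.+1 then Phi (driven_chain m w, xi m w) else s0.

Hypotheses (mPhi : measurable_fun setT Phi) (mxi : forall n, measurable_fun setT (xi n)).
Hypothesis xi_indep : forall n (A : nat -> set R), (forall i, measurable (A i)) ->
  P (\bigcap_(i in `I_n) xi i @^-1` A i) = (\prod_(i < n) P (xi i @^-1` A i))%E.
Local Open Scope ereal_scope.

Lemma measurable_driven_chain n : measurable_fun setT (driven_chain n).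
Proof.
elim: n => [|n ih] /=; first exact: measurable_cst.
by apply: (measurableT_comp mPhi); exact: measurable_fun_pair.
Qed.

Let future j n (A : nat -> set R) := \bigcap_(i in `I_n) xi (j + i)%N @^-1` A i.

Let measurable_future j n A : (forall i, measurable (A i)) -> measurable (future j n A).
Proof.
by move=> mA; apply: bigcap_measurableType => i _; rewrite -[X in measurable X]setTI; exact: mxi.
Qed.

Let futureS j n A : future j n.+1 A = xi j @^-1` A 0%N `&` future j.+1 n (fun i => A i.+1).
Proof.
apply/seteqP; split=> w /=.
  move=> h; split; first by have := h 0%N isT; rewrite addn0.
  by move=> i /= ni; have := h i.+1 ni; rewrite addnS.
move=> [h0 h] [|i] /= ni; first by rewrite addn0.
by have := h i ni; rewrite addSnnS.
Qed.

(** Carrying a whole block of future increments makes the induction on [j] close: the state at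
    [j.+1] is a function of the state at [j] and of [xi j], and the hypothesis for a block longer by
    one gives the joint law of this pair with the remaining future on rectangles. Uniqueness of
    measures extends it to [Phi @^-1] B. *)
Lemma driven_chain_future j n (A : nat -> set R) B :
  (forall i, measurable (A i)) -> measurable B ->
  P (driven_chain j @^-1` B `&` future j n A) =
  P (driven_chain j @^-1` B) * \prod_(i < n) P (xi (j + i)%N @^-1` A i).
Proof.
elim: j n A B => [|j ih] n A B mA mB.
  have [sB|sB] := pselect (B s0).
    rewrite (_ : driven_chain 0 @^-1` B = setT); last by apply/seteqP; split.
    by rewrite setTI probability_setT mul1e; exact: xi_indep.
  rewrite (_ : driven_chain 0 @^-1` B = set0); last by apply/seteqP; split.
  by rewrite set0I measure0 mul0e.
set E := future j.+1 n A.
have mE : measurable E by exact: measurable_future.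
set p := \prod_(i < n) _.
have p0 : 0 <= p by rewrite prode_ge0.
have pfin : p \is a fin_num.
  apply: prode_fin_num => i _; apply: fin_num_measure.
  by rewrite -[X in measurable X]setTI; exact: mxi.
have r0 : (0 <= fine p)%R by exact: fine_ge0.
pose r : {nonneg R} := NngNum r0.
have mc : measurable_fun setT (fun w => (driven_chain j w, xi j w)).
  by apply: measurable_fun_pair => //; exact: measurable_driven_chain.
pose c : {mfun T >-> (S * R)%type} := mfun_Sub (mem_set mc).
have [m1 m1E] : exists m1 : {measure set (S * R) -> \bar R},
    forall C, m1 C = P (c @^-1` C `&` E).
  by unshelve eexists (pushforward (mrestr P mE) c : {measure set _ -> \bar R}).
(* [m1] is the law of the pair restricted to the future event [E], [m2] its full law scaled by the
   product [p]; independence of [E] is their equality. *)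
pose m2 := mscale r (distribution P c).
have key C : measurable C -> m1 C = m2 C.
  pose G : set (set (S * R)) := 
    [set C | exists A, measurable A /\ exists B, measurable B /\ C = A `*` B].
  apply: (measure_unique G (fun=> setT)) => //.
  - rewrite measurable_prod_measurableType //; congr (<<s _ >>).
    rewrite predeqE => X; split => [[A' mA' [B' mB' <-]]|[A' [mA' [B' [mB' ->]]]]].
      by exists A'; split => //; exists B'.
    by exists A' => //; exists B'.
  - move=> _ _ [X1 [mX1 [X2 [mX2 ->]]]] [Y1 [mY1 [Y2 [mY2 ->]]]].
    rewrite -setXI; exists (X1 `&` Y1); split; first exact: measurableI.
    by exists (X2 `&` Y2); split => //; exact: measurableI.
  - by move=> _; exists setT; split => //; exists setT; rewrite setXTT.
  - exact: bigcup_const.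
  - move=> _ [B' [mB' [A' [mA' ->]]]].
    rewrite /= m1E /m2 /mscale /distribution /pushforward /=.
    rewrite -[distribution P c _]/(P (driven_chain j @^-1` B' `&` xi j @^-1` A')).
    rewrite (_ : c @^-1` _ = driven_chain j @^-1` B' `&` xi j @^-1` A'); last by [].
    (* The present constraint [A'] is put in front of the future ones. The hypothesis is used twice,
       with the block of length [n.+1] for the joint event and of length 1 for the present alone. *)
    pose A1 i := if i is i'.+1 then A i' else A'.
    have mA1 i : measurable (A1 i) by case: i.
    have := ih n.+1 A1 B' mA1 mB'; rewrite futureS/= -/E setIA => ->.
    have := ih 1%N A1 B' mA1 mB'; rewrite futureS/= [future _ 0 _](_ : _ = setT); last first.
      by apply/seteqP; split.
    rewrite setIT big_ord1 addn0/= => ->.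
    rewrite big_ord_recl/= addn0 fineK//.
    under eq_bigr do rewrite /bump/= add1n addnS -addSn.
    by rewrite -/p muleA muleC.
  - move=> _; rewrite /= m1E preimage_setT setTI.
    by rewrite (le_lt_trans (probability_le1 _ _))// ltry.
have mPB : measurable (Phi @^-1` B) by rewrite -[X in measurable X]setTI; exact: mPhi.
have := key _ mPB; rewrite m1E /m2 /mscale /distribution /pushforward/= fineK// muleC.
exact.
Qed.

Lemma driven_chain_independent j : independent_pair P (driven_chain j) (xi j).
Proof.
move=> B A mB mA.
have := @driven_chain_future j 1 (fun=> A) B (fun=> mA) mB.
rewrite futureS/= [future _ 0 _](_ : _ = setT); last by apply/seteqP; split.
by rewrite setIT big_ord1 addn0.
Qed.

End driven_chain.

Section square_integrable.
Context d (T : measurableType d) (R : realType) (P : probability T R).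
Local Open Scope ereal_scope.

Lemma integrable_sqr_le (f : T -> R) (C : R) : measurable_fun setT f ->
  \int[P]_w (f w ^+ 2)%:E <= C%:E -> P.-integrable setT (fun w => (f w ^+ 2)%:E).
Proof.
move=> mf fC; apply/integrableP; split.
  by apply/measurable_EFinP; exact: measurable_funX.
under eq_integral do rewrite /= ger0_norm ?sqr_ge0//.
by rewrite (le_lt_trans fC)// ltry.
Qed.

Lemma integrable_of_sqr (f : T -> R) : measurable_fun setT f ->
  P.-integrable setT (fun w => (f w ^+ 2)%:E) -> P.-integrable setT (fun w => (f w)%:E).
Proof.
move=> mf if2.
have i1 : P.-integrable setT (fun w => (1 + f w ^+ 2)%:E).
  have /= := @integrableD _ _ _ P setT measurableT (cst 1) (fun w => (f w ^+ 2)%:E).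
  by apply=> //; exact: finite_measure_integrable_cst.
apply: (le_integrable _ _ _ i1) => //; first exact/measurable_EFinP.
move=> w _ /=; rewrite lee_fin ler_norml.
have f2 := sqr_ge0 (f w).
rewrite [in X in (- X <= _)%R]ger0_norm ?addr_ge0// ger0_norm ?addr_ge0//.
by apply/andP; split; nra.
Qed.

Lemma integrable_mul_sqr (f g : T -> R) : measurable_fun setT f -> measurable_fun setT g ->
  P.-integrable setT (fun w => (f w ^+ 2)%:E) ->
  P.-integrable setT (fun w => (g w ^+ 2)%:E) ->
  P.-integrable setT (fun w => (f w * g w)%:E).
Proof.
move=> mf mg if2 ig2.
apply: (le_integrable _ _ _ (integrableD _ if2 ig2)) => //.
  by apply/measurable_EFinP; exact: measurable_funM.
move=> w _ /=; rewrite lee_fin ler_norml.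
have f2 := sqr_ge0 (f w + g w)%R; have g2 := sqr_ge0 (f w - g w)%R.
rewrite [in X in (- X <= _)%R]ger0_norm ?addr_ge0 ?sqr_ge0// ger0_norm ?addr_ge0 ?sqr_ge0//.
by apply/andP; split; nra.
Qed.

End square_integrable.

(** * Mean and variance of martingale sums *)

Section centered_sums.
Context d d' (T : measurableType d) (S : measurableType d') (R : realType)
  (P : probability T R).
Variables (Phi : S * R -> S) (s0 : S) (xi : nat -> T -> R).
Hypotheses (mPhi : measurable_fun setT Phi) (mxi : forall n, measurable_fun setT (xi n)).
Hypothesis xi_indep : forall n (A : nat -> set R), (forall i, measurable (A i)) ->
  P (\bigcap_(i in `I_n) xi i @^-1` A i) = (\prod_(i < n) P (xi i @^-1` A i))%E.
Variables (D : S * R -> R) (v : R).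
Hypotheses (mD : measurable_fun setT D).
Local Open Scope ereal_scope.
Hypothesis D_centered : forall j s, \int[P]_w (D (s, xi j w))%:E = 0.
Hypothesis D_sqr : forall j s, \int[P]_w (D (s, xi j w) ^+ 2)%:E <= v%:E.

Notation st := (driven_chain Phi s0 xi).

Definition driven_sum (n : nat) (w : T) : R := (\sum_(j < n) D (st j w, xi j w))%R.

(* The sum is itself carried along by a driven chain, on the state space S * R,
   so that it too is independent of the next increment. *)
Let Phi2 (z : (S * R) * R) : S * R := (Phi (z.1.1, z.2), (z.1.2 + D (z.1.1, z.2))%R).

Let m11 : measurable_fun setT (fun z : (S * R) * R => (z.1.1, z.2)).
Proof. by apply: measurable_fun_pair => //; exact: measurableT_comp. Qed.

Let mPhi2 : measurable_fun setT Phi2.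
Proof.
apply: measurable_fun_pair; first exact: measurableT_comp.
apply: measurable_funD; first exact: measurableT_comp.
exact: measurableT_comp.
Qed.

Let st2E n w : driven_chain Phi2 (s0, 0%R) xi n w = (st n w, driven_sum n w).
Proof.
elim: n => [|n ih] /=; first by rewrite /driven_sum big_ord0.
by rewrite ih /Phi2 /= /driven_sum big_ord_recr.
Qed.

Lemma measurable_driven_sum n : measurable_fun setT (driven_sum n).
Proof.
have := measurable_driven_chain (s0, 0%R : R) mPhi2 mxi n.
move=> /measurable_fun_pairP[_]; rewrite /comp.
by under eq_fun do rewrite st2E.
Qed.

Let mst n : measurable_fun setT (st n) := measurable_driven_chain s0 mPhi mxi n.
Let mDn n : measurable_fun setT (fun w => D (st n w, xi n w)).
Proof. by apply: (measurableT_comp mD); exact: measurable_fun_pair. Qed.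
Let mDs s n : measurable_fun setT (fun w => D (s, xi n w)).
Proof. by apply: (measurableT_comp mD); exact: measurable_fun_pair. Qed.

Let D_st_sqr n : \int[P]_w (D (st n w, xi n w) ^+ 2)%:E <= v%:E.
Proof.
have v0 : (0 <= v)%R.
  by rewrite -lee_fin (le_trans _ (D_sqr 0%N s0))// integral_ge0// => w _; rewrite lee_fin sqr_ge0.
have mD2 : measurable_fun setT (fun z => (D z ^+ 2)%:E).
  by apply/measurable_EFinP; exact: measurable_funX.
rewrite (ge0_integral_independent (mst n) (mxi n)
  (driven_chain_independent s0 mPhi mxi xi_indep n) mD2)//; last first.
  by move=> z; rewrite lee_fin sqr_ge0.
apply: (@le_trans _ _ (\int[P]_w v%:E)).
  apply: ge0_le_integral => //.
  - by move=> w _; apply: integral_ge0 => w' _; rewrite lee_fin sqr_ge0.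
  - have mF : measurable_fun setT (fun z : S * T => (D (z.1, xi n z.2) ^+ 2)%:E).
      apply: (measurableT_comp mD2); apply: measurable_fun_pair => //.
      exact: measurableT_comp.
    have mG := @measurable_fun_fubini_tonelli_F _ _ _ _ R P _ mF.
    apply: (measurableT_comp (mG _) (mst n)).
    by move=> z; rewrite lee_fin sqr_ge0.
by rewrite integral_cst//= probability_setT mule1.
Qed.

Let D_st_int n : P.-integrable setT (fun w => (D (st n w, xi n w) ^+ 2)%:E).
Proof. exact: integrable_sqr_le (D_st_sqr n). Qed.

(** Orthogonality of martingale increments: the mixed term is centered because the next increment is
    independent of the state and the sum together, so the second moments add. *)
Lemma driven_sum_sqr n : \int[P]_w (driven_sum n w ^+ 2)%:E <= (n%:R * v)%:E.
Proof.
elim: n => [|n ih].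
  under eq_integral do rewrite /driven_sum big_ord0 expr0n/=.
  by rewrite integral0 mul0r.
have iZ := integrable_sqr_le (measurable_driven_sum n) ih.
have iZD := integrable_mul_sqr (measurable_driven_sum n) (mDn n) iZ (D_st_int n).
have ZD0 : \int[P]_w (driven_sum n w * D (st n w, xi n w))%:E = 0.
  have m2 := measurable_driven_chain (s0, 0%R : R) mPhi2 mxi n.
  have ind := driven_chain_independent (s0, 0%R : R) mPhi2 mxi xi_indep n.
  pose g (z : (S * R) * R) := (z.1.2 * D (z.1.1, z.2))%R.
  have mg : measurable_fun setT g.
    by apply: measurable_funM; exact: measurableT_comp.
  have := integral_independent_centered m2 (mxi n) ind mg.
  rewrite /g/=; under eq_fun do rewrite st2E /=;
  apply => // -[s z] /=.
    have := integrable_of_sqr (mDs s n) (integrable_sqr_le (mDs s n) (D_sqr n s)).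
    by move=> /(@integrableZl _ _ _ P setT measurableT z).
  under eq_integral do rewrite EFinM.
  rewrite integralZl// ?D_centered ?mule0//.
  exact: integrable_of_sqr (mDs s n) (integrable_sqr_le (mDs s n) (D_sqr n s)).
have -> : \int[P]_w (driven_sum n.+1 w ^+ 2)%:E = \int[P]_w ((driven_sum n w ^+ 2)%:E +
    (2%:E * (driven_sum n w * D (st n w, xi n w))%:E + (D (st n w, xi n w) ^+ 2)%:E)).
  apply: eq_integral => w _; rewrite -EFinM -!EFinD /driven_sum big_ord_recr/=.
  by congr EFin; ring.
rewrite integralD//; last by apply: integrableD => //; exact: integrableZl.
rewrite integralD//; last exact: integrableZl.
rewrite integralZl// ZD0 mule0 add0e -natr1 mulrDl mul1r EFinD.
exact: leeD.
Qed.

Lemma integrable_driven_sum_sqr n : P.-integrable setT (fun w => (driven_sum n w ^+ 2)%:E).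
Proof. exact: integrable_sqr_le (measurable_driven_sum n) (driven_sum_sqr n). Qed.

Lemma integrable_driven_sum n : P.-integrable setT (fun w => (driven_sum n w)%:E).
Proof. exact: integrable_of_sqr (measurable_driven_sum n) (integrable_driven_sum_sqr n). Qed.

Lemma driven_sum_centered n : \int[P]_w (driven_sum n w)%:E = 0.
Proof.
elim: n => [|n ih].
  by under eq_integral do rewrite /driven_sum big_ord0; rewrite integral0.
have iD := integrable_of_sqr (mDn n) (D_st_int n).
have -> : \int[P]_w (driven_sum n.+1 w)%:E =
    \int[P]_w ((driven_sum n w)%:E + (D (st n w, xi n w))%:E).
  by apply: eq_integral => w _; rewrite -EFinD /driven_sum big_ord_recr.
rewrite integralD//; last exact: integrable_driven_sum.
rewrite ih add0e.
apply: (integral_independent_centered (mst n) (mxi n)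
  (driven_chain_independent s0 mPhi mxi xi_indep n) mD) => // s.
exact: integrable_of_sqr (mDs s n) (integrable_sqr_le (mDs s n) (D_sqr n s)).
Qed.

End centered_sums.

(** * Gaussian moments *)

Lemma is_derive_ge0_ge (R : realType) (f df : R -> R) (z : R) :
  (forall x : R, is_derive x 1 f (df x)) -> (forall x, 0 <= x -> 0 <= df x) ->
  0 <= z -> f 0 <= f z.
Proof.
move=> fdf df0 z0.
have cf : {within `[0, z], continuous f}.
  apply: continuous_subspaceT => x.
  by apply/differentiable_continuous/derivable1_diffP; have [] := fdf x.
have [c cz fE] := MVT_segment z0 (fun x _ => fdf x) cf.
rewrite -subr_ge0 fE mulr_ge0 ?subr0// df0//.
by move: cz; rewrite in_itv/= => /andP[].
Qed.

Section exponential_taylor.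
Variable R : realType.
Implicit Types z : R.

Let expRN_ge z : 1 - z <= expR (- z).
Proof. exact: (expR_ge1Dx (- z)). Qed.

Lemma expR_sub1_le z : expR z - 1 <= z * expR z.
Proof.
have := ler_wpM2r (expR_ge0 z) (expRN_ge z).
by rewrite -expRD addNr expR0; lra.
Qed.

Lemma expR_sub1_ge0 z : 0 <= z -> 0 <= expR z - 1.
Proof. by move=> z0; have := expR_ge1Dx z; lra. Qed.

Lemma expR_taylor1_le z : 0 <= z -> expR z - 1 - z <= z ^+ 2 * expR z.
Proof.
move=> z0; have := expR_sub1_le z; have := ler_wpM2l z0 (expR_sub1_le z).
by rewrite expr2; lra.
Qed.

Lemma expR_taylor2_ge0 z : 0 <= z -> 0 <= expR z - 1 - z - z ^+ 2 / 2.
Proof.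
move=> z0.
have := @is_derive_ge0_ge R (fun x => expR x - 1 - x - x ^+ 2 / 2) (fun x => expR x - 1 - x) z.
rewrite expR0 expr0n/= mul0r !subr0 subrr; apply=> // [x|x x0].
  apply: is_derive_eq; rewrite /GRing.scale/=; by field.
by have := expR_ge1Dx x; lra.
Qed.

Lemma expR_taylor2_le z : 0 <= z -> expR z - 1 - z - z ^+ 2 / 2 <= z ^+ 3 * expR z.
Proof.
move=> z0.
have := @is_derive_ge0_ge R (fun x => x ^+ 3 * expR x - (expR x - 1 - x - x ^+ 2 / 2))
  (fun x => 3 * x ^+ 2 * expR x + x ^+ 3 * expR x - (expR x - 1 - x)) z.
rewrite expR0 !expr0n/= !mul0r !subr0 subrr subr0 subr_ge0; apply=> // [x|x x0].
  apply: is_derive_eq; rewrite /GRing.scale/=; by field.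
have := expR_taylor1_le x0; have e0 := expR_ge0 x.
have := mulr_ge0 (exprn_ge0 3 x0) e0; have := mulr_ge0 (exprn_ge0 2 x0) e0.
by lra.
Qed.

Lemma expRN_taylor2_le0 z : 0 <= z -> expR (- z) - 1 + z - z ^+ 2 / 2 <= 0.
Proof.
move=> z0.
have := @is_derive_ge0_ge R (fun x => - (expR (- x) - 1 + x - x ^+ 2 / 2))
  (fun x => expR (- x) - 1 + x) z.
rewrite oppr0 expR0 !expr0n/= !mul0r subrr addr0 subr0 oppr0 oppr_ge0; apply=> // [x|x x0].
  apply: is_derive_eq; rewrite /GRing.scale/=; by field.
by have := expRN_ge x; lra.
Qed.

Lemma expRN_taylor2_ge z : 0 <= z -> - z ^+ 3 <= expR (- z) - 1 + z - z ^+ 2 / 2.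
Proof.
move=> z0.
suff : 0 <= expR (- z) - 1 + z - z ^+ 2 / 2 + z ^+ 3 by lra.
have := @is_derive_ge0_ge R (fun x => expR (- x) - 1 + x - x ^+ 2 / 2 + x ^+ 3)
  (fun x => - expR (- x) + 1 - x + 3 * x ^+ 2) z.
rewrite oppr0 expR0 !expr0n/= !mul0r subrr addr0 subr0 addr0; apply => // [x|x x0].
  apply: is_derive_eq; rewrite /GRing.scale/=; by field.
have := expR_ge1Dx x; have e0 := expR_gt0 (- x).
rewrite -(ler_pM2l e0) -expRD addNr expR0 => h.
(* From [expR (- x) * (1 + x) <= 1] and (1 - x + x^2)(1 + x) = 1 + x^3 >= 1. *)
suff : expR (- x) <= 1 - x + x ^+ 2 by have := sqr_ge0 x; lra.
rewrite -(ler_pM2r (_ : 0 < 1 + x)); last by rewrite ltr_wpDr.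
rewrite (le_trans h)//; have := exprn_ge0 3 x0; rewrite !exprS expr0; lra.
Qed.

Lemma expR_taylor2 z : `|expR z - 1 - z - z ^+ 2 / 2| <= `|z| ^+ 3 * expR `|z|.
Proof.
case: (leP 0 z) => [z0|/ltW z0].
  rewrite (ger0_norm z0) ger0_norm ?expR_taylor2_ge0//; exact: expR_taylor2_le.
have {z z0} [z -> z0] : exists2 w, z = - w & 0 <= w.
  by exists (- z); rewrite ?opprK ?oppr_ge0.
rewrite normrN (ger0_norm z0).
have h1 := expRN_taylor2_le0 z0; have h2 := expRN_taylor2_ge z0.
rewrite sqrrN opprK ler_norml; apply/andP; split.
  have e1 : 1 <= expR z by rewrite -expR0 ler_expR.
  by have := ler_peMr (exprn_ge0 3 z0) e1; lra.
by have := mulr_ge0 (exprn_ge0 3 z0) (expR_ge0 z); lra.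
Qed.

End exponential_taylor.

Section normal_moments.
Variables (R : realType) (s : R).
Hypothesis s0 : 0 < s.
Local Notation nu := (@normal_prob R 0 s).
Local Notation mu := (@lebesgue_measure R).

(** The change of variables introduces the Radon-Nikodym derivative, which equals the density almost
    everywhere since both have the same integral over every measurable set. *)
Lemma ge0_integral_normal_prob (m : R) (f : R -> \bar R) :
  measurable_fun setT f -> (forall x, 0 <= f x)%E ->
  (\int[normal_prob m s]_x f x = \int[mu]_x (f x * (normal_pdf m s x)%:E))%E.
Proof.
move=> mf f0.
have dom := normal_prob_dominates m s.
have mpdf : measurable_fun setT (fun x => (normal_pdf m s x)%:E).
  by apply/measurable_EFinP; exact: measurable_normal_pdf.
rewrite -(Radon_Nikodym_SigmaFinite.change_of_variables dom f0 measurableT mf).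
have mrn := measurable_int _ (Radon_Nikodym_SigmaFinite.f_integrable dom).
apply: ge0_ae_eq_integral => //.
- exact: emeasurable_funM.
- exact: emeasurable_funM.
- by move=> x _; rewrite mule_ge0// Radon_Nikodym_SigmaFinite.f_ge0.
- by move=> x _; rewrite mule_ge0// lee_fin normal_pdf_ge0.
- apply: ae_eqe_mul2l; apply: integral_ae_eq => //.
    exact: Radon_Nikodym_SigmaFinite.f_integrable.
  by move=> E _ mE; rewrite -Radon_Nikodym_SigmaFinite.f_integral.
Qed.

(** Completing the square: tilting the centered density by [expR (l * x)] gives a constant times the
    normal density with mean [l * s ^+ 2]. *)
Lemma normal_mgf (l : R) :
  (\int[nu]_x (expR (l * x))%:E = (expR (l ^+ 2 * s ^+ 2 / 2))%:E)%E.
Proof.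
have mexp : measurable_fun setT (fun x : R => (expR (l * x))%:E).
  by apply/measurable_EFinP; apply: measurableT_comp => //; exact: measurable_funM.
rewrite ge0_integral_normal_prob//.
transitivity (\int[mu]_x ((expR (l ^+ 2 * s ^+ 2 / 2))%:E *
    (normal_pdf (l * s ^+ 2) s x)%:E))%E.
  apply: eq_integral => x _; rewrite -!EFinM; congr EFin.
  rewrite !normal_pdfE ?gt_eqF// mulrCA [RHS]mulrCA; congr (_ * _).
  rewrite /normal_fun -!expRD; congr expR.
  rewrite subr0 !mulr2n; field.
  by rewrite -mulr2n -mulr_natr mulf_neq0 ?expf_neq0 ?gt_eqF ?pnatr_eq0.
rewrite ge0_integralZl//.
- by rewrite integral_normal_pdf mule1.
- by apply/measurable_EFinP; exact: measurable_normal_pdf.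
- by move=> x _; rewrite lee_fin normal_pdf_ge0.
Qed.

Lemma integrable_normal_exp (l : R) : nu.-integrable setT (fun x => (expR (l * x))%:E).
Proof.
apply/integrableP; split.
  by apply/measurable_EFinP; apply: measurableT_comp => //; exact: measurable_funM.
under eq_integral do rewrite /= ger0_norm ?expR_ge0//.
by rewrite normal_mgf ltry.
Qed.

Lemma integrable_normal_dominated (f : R -> R) (C l : R) : measurable_fun setT f ->
  (forall x, `|f x| <= C * (expR (l * x) + expR (- l * x))) ->
  nu.-integrable setT (fun x => (f x)%:E).
Proof.
move=> mf fC.
have i1 := integrableD measurableT (integrable_normal_exp l) (integrable_normal_exp (- l)).
have := integrableZl measurableT C i1.
apply: le_integrable => //; first exact/measurable_EFinP.
move=> x _ /=; rewrite lee_fin.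
by rewrite (le_trans (fC x))// ler_norm.
Qed.

Let expR_norm_le (l x : R) : 0 <= l -> expR (l * `|x|) <= expR (l * x) + expR (- l * x).
Proof.
move=> l0; case: (leP 0 x) => x0; first by rewrite ger0_norm// lerDl expR_ge0.
by rewrite ltr0_norm// mulrN -mulNr lerDr expR_ge0.
Qed.

Let exprn_le_expR (n : nat) (x : R) : `|x| ^+ n.+1 <= n.+1`!%:R * expR `|x|.
Proof.
have := expR_ge1Dxn n (normr_ge0 x).
have f0 : 0 < n.+1`!%:R :> R by rewrite ltr0n fact_gt0.
rewrite -(ler_pM2l f0) mulrDr mulr1 mulrCA divff ?gt_eqF// mulr1.
by apply: le_trans; rewrite lerDr ltW.
Qed.

Lemma integrable_normal_exprn (n : nat) : nu.-integrable setT (fun x => (x ^+ n.+1)%:E).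
Proof.
apply: (@integrable_normal_dominated _ n.+1`!%:R 1); first exact: measurable_funX.
move=> x; rewrite normrX (le_trans (exprn_le_expR n x))// ler_wpM2l//.
by have := expR_norm_le x ler01; rewrite (mul1r `|x|).
Qed.

Let integrable_normal_id : nu.-integrable setT (fun x => x%:E) := integrable_normal_exprn 0.

Let remainder (x : R) := `|x| ^+ 3 * expR `|x|.

Let integrable_remainder : nu.-integrable setT (fun x => (remainder x)%:E).
Proof.
apply: (@integrable_normal_dominated _ 6 2).
  apply: measurable_funM; last exact: measurableT_comp.
  by apply: measurable_funX; exact: normr_measurable.
move=> x; rewrite /remainder ger0_norm ?mulr_ge0 ?expR_ge0// ?exprn_ge0//.
have h := expR_norm_le x (ler0n R 2).
rewrite (le_trans _ (ler_wpM2l (ler0n R 6) h))//.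
rewrite (_ : 2 * `|x| = `|x| + `|x|); last by ring.
rewrite expRD mulrA ler_wpM2r ?expR_ge0//.
Qed.

Let small_eq0 (p K : R) : (forall l : R, 0 < l <= 1 -> `|p| <= l * K) -> p = 0.
Proof.
move=> h; apply/eqP; rewrite -normr_le0 leNgt; apply/negP => p0.
have K0 : 0 < K.
  by have := h 1; rewrite ltr01 lexx mul1r => /(_ isT); exact: lt_le_trans.
pose l := Num.min 1 (`|p| / (2 * K)).
have l0 : 0 < l by rewrite lt_min ltr01 divr_gt0// mulr_gt0.
have l1 : l <= 1 by rewrite ge_min lexx.
have := h l; rewrite l0 l1 => /(_ isT); apply/negP; rewrite -ltNge.
have : l * K <= `|p| / (2 * K) * K by rewrite ler_wpM2r ?(ltW K0)// ge_min lexx orbT.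
have -> : `|p| / (2 * K) * K = `|p| / 2 by field; rewrite gt_eqF.
by move=> /le_lt_trans; apply; lra.
Qed.

(* Comparing the moment generating function with its second order expansion, the
   mean and the second moment are read off as l tends to 0. *)
Let normal_expansion : exists K : R, forall l : R, 0 < l <= 1 ->
  `|- (\int[nu]_x x) + l * ((s ^+ 2 - \int[nu]_x (x ^+ 2)) / 2)| <= l ^+ 2 * K.
Proof.
set A := \int[nu]_x x; set B := \int[nu]_x (x ^+ 2).
pose K0 := \int[nu]_x (remainder x).
exists (K0 + s ^+ 4 * expR (s ^+ 2)) => l /andP[l0 l1].
have i2 := integrable_normal_exprn 1.
have i1 : nu.-integrable setT (EFin \o (fun=> 1 : R)).
  exact: finite_measure_integrable_cst.
have iex : nu.-integrable setT (EFin \o (fun x => expR (l * x))) := integrable_normal_exp l.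
have ilx : nu.-integrable setT (EFin \o (fun x => l * x)).
  exact: (integrableZl measurableT l integrable_normal_id).
have ilx2 : nu.-integrable setT (EFin \o (fun x => l ^+ 2 / 2 * x ^+ 2)).
  exact: (integrableZl measurableT (l ^+ 2 / 2) i2).
have ig1 : nu.-integrable setT (EFin \o (fun x => expR (l * x) - 1)).
  exact: (integrableB measurableT iex i1).
have ig2 : nu.-integrable setT (EFin \o (fun x => expR (l * x) - 1 - l * x)).
  exact: (integrableB measurableT ig1 ilx).
have ig3 : nu.-integrable setT (EFin \o (fun x => expR (l * x) - 1 - l * x - l ^+ 2 / 2 * x ^+ 2)).
  exact: (integrableB measurableT ig2 ilx2).
have gE : \int[nu]_x (expR (l * x) - 1 - l * x - l ^+ 2 / 2 * x ^+ 2) =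
    expR (l ^+ 2 * s ^+ 2 / 2) - 1 - l * A - l ^+ 2 / 2 * B.
  rewrite RintegralB// RintegralB// RintegralB// RintegralZl// RintegralZl//.
  rewrite Rintegral_cst// -/A -/B; congr (_ - _ - _ - _).
    by rewrite /Rintegral normal_mgf.
  by rewrite mul1r [X in fine X]probability_setT.
have gK : `|expR (l ^+ 2 * s ^+ 2 / 2) - 1 - l * A - l ^+ 2 / 2 * B| <= l ^+ 3 * K0.
  rewrite -gE (le_trans (le_normr_Rintegral measurableT ig3))//.
  rewrite -RintegralZl//; apply: le_Rintegral => //.
  - exact: (integrable_norm ig3).
  - exact: (integrableZl measurableT (l ^+ 3) integrable_remainder).
  - move=> x _; rewrite (_ : l ^+ 2 / 2 * x ^+ 2 = (l * x) ^+ 2 / 2); last by ring.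
    rewrite (le_trans (expR_taylor2 _))// /remainder normrM (ger0_norm (ltW l0)).
    rewrite exprMn -mulrA ler_wpM2l ?exprn_ge0 ?(ltW l0)// ler_wpM2l ?exprn_ge0//.
    by rewrite ler_expR ler_piMl.
set u := l ^+ 2 * s ^+ 2 / 2 in gK.
have u0 : 0 <= u by rewrite /u divr_ge0// mulr_ge0 ?sqr_ge0.
have h1 := expR_ge1Dx u; have h2 := expR_taylor1_le u0.
have h3 : u ^+ 2 * expR u <= l ^+ 3 * (s ^+ 4 * expR (s ^+ 2)).
  rewrite mulrA ler_pM ?sqr_ge0 ?expR_ge0//.
    rewrite /u (_ : (l ^+ 2 * s ^+ 2 / 2) ^+ 2 = l ^+ 3 * s ^+ 4 * (l / 4)); last by field.
    rewrite ler_piMr ?mulr_ge0 ?exprn_ge0 ?(ltW l0) ?(ltW s0)//.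
    by rewrite ler_pdivrMr// mul1r (le_trans l1)// ler1n.
  rewrite ler_expR /u -mulrA mulrC -mulrA ler_piMr ?sqr_ge0//.
  have l21 : l ^+ 2 <= 1 by rewrite expr_le1// ltW.
  by rewrite mulrC; have := sqr_ge0 l; lra.
(* Multiplied by [l], the quantity is the remainder of the expansion under the integral minus the
   remainder [expR u - 1 - u] of the closed form; both are of order l^3. *)
rewrite -(ler_pM2l l0) -[X in X * `|_|](ger0_norm (ltW l0)) -normrM.
have -> : l * (- A + l * ((s ^+ 2 - B) / 2)) =
    (expR u - 1 - l * A - l ^+ 2 / 2 * B) - (expR u - 1 - u).
  by rewrite /u; field.
rewrite (le_trans (ler_normB _ _))// mulrA -exprS mulrDr lerD// ger0_norm; lra.
Qed.

Lemma normal_mean : \int[nu]_x x = 0.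
Proof.
have [K hK] := normal_expansion; set A := \int[nu]_x x in hK *.
set q := (_ / 2) in hK.
apply: (@small_eq0 _ (`|q| + K)) => l l01.
have := hK l l01; move/andP: l01 => [l0 l1].
move=> h.
have K0 : 0 <= K by rewrite -(pmulr_rge0 _ (exprn_gt0 2 l0)); exact: le_trans h.
have h2 : l ^+ 2 * K <= l * K by rewrite expr2 -mulrA ler_pM2l// ler_piMl.
have := ler_normB (l * q) (- A + l * q).
have -> : l * q - (- A + l * q) = A by ring.
rewrite normrM (ger0_norm (ltW l0)); lra.
Qed.

Lemma normal_second_moment : \int[nu]_x (x ^+ 2) = s ^+ 2.
Proof.
have [K hK] := normal_expansion; rewrite normal_mean oppr0 in hK.
set q := (_ / 2) in hK.
have : q = 0.
  apply: (@small_eq0 _ K) => l l01; have := hK l l01; move/andP: l01 => [l0 l1].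
  by rewrite add0r normrM ger0_norm ?(ltW l0)// expr2 -mulrA ler_pM2l.
by rewrite /q; lra.
Qed.

(** Only the order [s ^+ 4] matters, as it makes the variance of a step linear in the mesh. Applying
    z^4 <= 4! exp |z| to z = x / s gives 48 as 24 for each of the two exponentials. *)
Lemma normal_fourth_moment_le : \int[nu]_x (x ^+ 4) <= 48 * expR 1 * s ^+ 4.
Proof.
have sn0 : s != 0 by rewrite gt_eqF.
have i1 := integrable_normal_exp s^-1; have i2 := integrable_normal_exp (- s^-1).
have ile : \int[nu]_x (x ^+ 4) <=
    \int[nu]_x (24 * s ^+ 4 * (expR (s^-1 * x) + expR (- s^-1 * x))).
  apply: le_Rintegral => //.
  - exact: (integrable_normal_exprn 3).
  - have i12 := integrableD measurableT i1 i2.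
    exact: (integrableZl measurableT (24 * s ^+ 4) i12).
  - move=> x _; have si0 : 0 <= s^-1 by rewrite invr_ge0 ltW.
    rewrite (_ : x ^+ 4 = s ^+ 4 * `|s^-1 * x| ^+ 4); last first.
      by rewrite -normrX ger0_norm ?exprn_even_ge0//; field.
    set E := expR _ + _; rewrite (_ : 24 * s ^+ 4 * E = s ^+ 4 * (24 * E)); last by ring.
    rewrite ler_wpM2l ?exprn_ge0 ?(ltW s0)//.
    have := exprn_le_expR 3 (s^-1 * x); rewrite (_ : 4`! = 24%N)// => /le_trans; apply.
    by rewrite ler_wpM2l// normrM (ger0_norm si0) expR_norm_le.
rewrite (le_trans ile)// RintegralZl//; last exact: (integrableD measurableT i1 i2).
rewrite RintegralD// /Rintegral !normal_mgf/= sqrrN.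
have -> : s^-1 ^+ 2 * s ^+ 2 / 2 = 1 / 2 by field.
have e1 : expR (1 / 2) <= expR 1 :> R by rewrite ler_expR; lra.
have := ler_wpM2l (exprn_ge0 4 (ltW s0)) e1; lra.
Qed.

End normal_moments.

(** * The function f of the martingale *)

Section mean_drawdown_functions.
Variables (R : realType) (k : R).
Implicit Types z : R.

(* The iterated primitives of expR (k z) that vanish at 0; the value at k = 0 is
   the limit. *)
Definition expm1_fun z : R := if k == 0 then z else (expR (k * z) - 1) / k.

Definition expm2_fun z : R :=
  if k == 0 then z ^+ 2 / 2 else (expR (k * z) - 1 - k * z) / k ^+ 2.

Lemma expm1_fun0 : expm1_fun 0 = 0.
Proof. by rewrite /expm1_fun mulr0 expR0 subrr mul0r if_same. Qed.

Lemma expm2_fun0 : expm2_fun 0 = 0.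
Proof. by rewrite /expm2_fun mulr0 expR0 subrr subr0 expr0n/= !mul0r if_same. Qed.

Lemma expm1_funE z : expm1_fun z = z + k * expm2_fun z.
Proof.
rewrite /expm1_fun /expm2_fun; case: eqP => [->|/eqP k0]; first by rewrite mul0r addr0.
by field.
Qed.

Lemma continuous_expm2_fun : continuous expm2_fun.
Proof.
move=> z; rewrite /expm2_fun; case: eqP => _.
  by apply: cvgM; [exact: exprn_continuous|exact: cvg_cst].
apply: cvgM; last exact: cvg_cst.
apply: cvgB; last by apply: cvgM; [exact: cvg_cst|exact: cvg_id].
apply: cvgB; last exact: cvg_cst.
apply: (cvg_comp (fun z => k * z) expR); last exact: continuous_expR.
by apply: cvgM; [exact: cvg_cst|exact: cvg_id].
Qed.

Lemma continuous_expm1_fun : continuous expm1_fun.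
Proof.
move=> z; rewrite (_ : expm1_fun = fun z => z + k * expm2_fun z); last first.
  by apply/funext => x; exact: expm1_funE.
apply: cvgD; first exact: cvg_id.
by apply: cvgM; [exact: cvg_cst|exact: continuous_expm2_fun].
Qed.

Lemma expm2_fun_ge0 z : 0 <= expm2_fun z.
Proof.
rewrite /expm2_fun; case: eqP => _; first by rewrite divr_ge0 ?sqr_ge0.
by rewrite divr_ge0 ?sqr_ge0//; have := expR_ge1Dx (k * z); lra.
Qed.

(* With u = k z1 and v = k z2, convexity gives
   expR v - expR u >= expR u (v - u), and (expR u - 1) (v - u) >= 0 since
   u and v - u have the same sign. *)
Lemma expm2_fun_homo z1 z2 : 0 <= z1 -> z1 <= z2 -> expm2_fun z1 <= expm2_fun z2.
Proof.
move=> z10 z12; rewrite /expm2_fun; case: eqP => [_|/eqP k0].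
  by rewrite ler_pM2r// ler_sqr ?nnegrE// (le_trans z10).
rewrite ler_pM2r ?invr_gt0 ?exprn_even_gt0//.
set u := k * z1; set v := k * z2.
have := ler_wpM2l (expR_ge0 u) (expR_ge1Dx (v - u)).
rewrite -expRD subrKC => h.
suff : 0 <= (expR u - 1) * (v - u) by lra.
have -> : v - u = k * (z2 - z1) by rewrite mulrBr.
case: (leP 0 k) => [kge|/ltW kle].
  by rewrite mulr_ge0 ?mulr_ge0 ?subr_ge0// -expR0 ler_expR mulr_ge0.
rewrite mulr_le0 ?mulr_le0_ge0 ?subr_ge0// subr_le0 -expR0 ler_expR.
by rewrite mulr_le0_ge0.
Qed.

Lemma expm1_fun_homo z1 z2 : z1 <= z2 -> expm1_fun z1 <= expm1_fun z2.
Proof.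
move=> z12; rewrite /expm1_fun; case: eqP => [//|/eqP].
case: (ltgtP 0 k) => // kn _.
  by rewrite ler_pM2r ?invr_gt0// lerD2r ler_expR ler_pM2l.
by rewrite ler_nM2r ?invr_lt0// lerD2r ler_expR ler_nM2l.
Qed.

Lemma expm2_fun_le z : k * z <= 1 / 2 -> expm2_fun z <= 2 * z ^+ 2.
Proof.
move=> kz; rewrite /expm2_fun; case: eqP => [_|/eqP k0].
  by have := sqr_ge0 z; lra.
rewrite ler_pdivrMr ?exprn_even_gt0// (_ : 2 * z ^+ 2 * k ^+ 2 = 2 * (k * z) ^+ 2); last by ring.
move: (k * z) kz => x x2; case: (leP 0 x) => x0.
  have h1 := expR_sub1_le x; have h2 := expR_taylor1_le x0; have e0 := expR_ge0 x.
  have e2 : expR x <= 2 by nra.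
  by rewrite (le_trans h2)// [leRHS]mulrC ler_wpM2l ?sqr_ge0.
have {}x0 : 0 <= - x by lra.
by have := expRN_taylor2_le0 x0; rewrite opprK sqrrN; have := sqr_ge0 x; lra.
Qed.

Lemma expm1_fun_le z : z <= 0 -> `|k| * - z <= 1 / 4 -> expm1_fun z <= z / 2.
Proof.
move=> z0 kz; rewrite expm1_funE.
have kz2 : `|k * z| <= 1 / 4 by rewrite normrM (ler0_norm z0).
have h1 : expm2_fun z <= 2 * z ^+ 2.
  by apply: expm2_fun_le; move: kz2; rewrite ler_norml => /andP[_]; lra.
have h2 : k * expm2_fun z <= `|k| * (2 * z ^+ 2).
  rewrite (le_trans (ler_wpM2r (expm2_fun_ge0 z) (ler_norm k)))//.
  by rewrite ler_wpM2l.
have := ler_wpM2r (_ : 0 <= - z) kz; rewrite oppr_ge0 => /(_ z0).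
by move: h2; rewrite expr2; lra.
Qed.

End mean_drawdown_functions.

(* The solution of (sigma^2 / 2) f'' - mu f' = 1, f(0) = 0, f'(0) = delta. *)
Definition mean_drawdown_fun (R : realType) (mu sigma delta z : R) : R :=
  2 / sigma ^+ 2 * expm2_fun (2 * mu / sigma ^+ 2) z +
  delta * expm1_fun (2 * mu / sigma ^+ 2) z.

Section mean_drawdown_fun_theory.
Variables (R : realType) (mu sigma : R).
Hypothesis sigma0 : 0 < sigma.
Notation k := (2 * mu / sigma ^+ 2).
Notation f := (mean_drawdown_fun mu sigma).

Lemma mean_drawdown_fun0 delta : f delta 0 = 0.
Proof. by rewrite /mean_drawdown_fun expm1_fun0 expm2_fun0 !mulr0 addr0. Qed.

Lemma continuous_mean_drawdown_fun delta : continuous (f delta).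
Proof.
move=> z; apply: cvgD.
  by apply: cvgM; [exact: cvg_cst|exact: continuous_expm2_fun].
by apply: cvgM; [exact: cvg_cst|exact: continuous_expm1_fun].
Qed.

Let s20 : 0 < 2 / sigma ^+ 2. Proof. by rewrite divr_gt0// exprn_gt0. Qed.

Lemma mean_drawdown_fun_ge0 z : 0 <= f 0 z.
Proof. by rewrite /mean_drawdown_fun mul0r addr0 mulr_ge0 ?(ltW s20)// expm2_fun_ge0. Qed.

Lemma mean_drawdown_fun_homo delta z1 z2 : 0 <= delta -> 0 <= z1 -> z1 <= z2 ->
  f delta z1 <= f delta z2.
Proof.
move=> d0 z10 z12; apply: lerD; first by rewrite ler_pM2l// expm2_fun_homo.
by rewrite ler_wpM2l// expm1_fun_homo.
Qed.

(** Left of 0 the term of slope [delta] is negative of order |z| and beats the nonnegative term,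
    which is of order z^2. *)
Lemma mean_drawdown_fun_le0 delta : 0 < delta ->
  exists2 eta, 0 < eta & forall z, - eta <= z <= 0 -> f delta z <= 0.
Proof.
move=> d0.
have k1 : 0 < `|k| + 1 by rewrite ltr_wpDl.
(* The first bound makes (4 / sigma^2) |z| <= delta / 2; the second makes |k z| <= 1/4, where the
   estimates of both primitives apply, and its [+ 1] covers [k = 0]. *)
pose eta := Num.min (delta * sigma ^+ 2 / 8) (1 / (4 * (`|k| + 1))).
have e0 : 0 < eta.
  by rewrite lt_min !divr_gt0 ?mulr_gt0// exprn_gt0.
exists eta => // z /andP[ez z0].
have kz : `|k| * - z <= 1 / 4.
  have : - z <= 1 / (4 * (`|k| + 1)).
    by rewrite (le_trans _ (_ : eta <= _))//; [lra|rewrite /eta ge_min lexx orbT].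
  rewrite ler_pdivlMr ?mulr_gt0// => h.
  have zz : 0 <= - z by lra.
  lra.
have kz2 : k * z <= 1 / 2.
  have : `|k * z| <= 1 / 4 by rewrite normrM (ler0_norm z0).
  by rewrite ler_norml => /andP[_]; lra.
have h1 := ler_wpM2l (ltW s20) (expm2_fun_le kz2).
have h2 := ler_wpM2l (ltW d0) (expm1_fun_le z0 kz).
rewrite (le_trans (lerD h1 h2))//.
have -> : 2 / sigma ^+ 2 * (2 * z ^+ 2) + delta * (z / 2) =
    - z * (4 / sigma ^+ 2 * - z - delta / 2) by field; rewrite gt_eqF.
rewrite mulr_ge0_le0 ?oppr_ge0// subr_le0 mulrAC ler_pdivrMr ?exprn_gt0//.
have : - z <= delta * sigma ^+ 2 / 8.
  by rewrite (le_trans _ (_ : eta <= _))//; [lra|rewrite /eta ge_min lexx].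
by lra.
Qed.

Variable a : R.
Hypothesis a0 : 0 < a.

Lemma mean_drawdown_fun_gt0 : 0 < f 0 a.
Proof.
rewrite /mean_drawdown_fun mul0r addr0 mulr_gt0// /expm2_fun; case: eqP => [_|/eqP k0].
  by rewrite divr_gt0// exprn_gt0.
rewrite divr_gt0 ?exprn_even_gt0//.
have ka0 : k * a != 0 by rewrite mulf_neq0// gt_eqF.
by have := expR_gt1Dx ka0; lra.
Qed.

(** The slack below [f 0 a] pays for a level [b < a], required because the grid count dominates the
    true one only below level [a]. *)
Lemma mean_drawdown_fun_lower c : c < f 0 a ->
  exists2 b, 0 < b < a & forall z, b <= z -> c <= f 0 z.
Proof.
move=> ca.
have e0 : 0 < f 0 a - c by rewrite subr_gt0.
have /cvgrPdist_lt/(_ _ e0) := @continuous_mean_drawdown_fun 0 a.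
move=> /nbhs_ballP[/= r r0 rP]; change (is_true (0 < r :> R)) in r0.
pose b := Num.max (a / 2) (a - r / 2).
have b0 : 0 < b by rewrite /b lt_max divr_gt0.
have ba : b < a by rewrite /b gt_max ltr_pdivrMr// ltr_pMr// ltr1n gtrBl divr_gt0.
exists b; first by rewrite b0.
move=> z bz; rewrite (le_trans _ (mean_drawdown_fun_homo (lexx 0) (ltW b0) bz))//.
have : ball a r b.
  rewrite /ball/= ger0_norm ?subr_ge0 ?(ltW ba)//.
  have : a - r / 2 <= b by rewrite /b le_max lexx orbT.
  lra.
by move=> /rP; rewrite ltr_norml => /andP[_]; lra.
Qed.

(** Half of the slack above [f 0 a] pays for the overshoot beyond [a], the other half for the slope
    [delta]. *)
Lemma mean_drawdown_fun_upper c : f 0 a < c ->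
  exists delta eta, [/\ 0 < eta, forall z, - eta <= z <= 0 -> f delta z <= 0 &
    forall z, 0 <= z <= a + eta -> f delta z <= c].
Proof.
move=> ca.
have e0 : 0 < (c - f 0 a) / 2 by rewrite divr_gt0// subr_gt0.
have /cvgrPdist_lt/(_ _ e0) := @continuous_mean_drawdown_fun 0 a.
move=> /nbhs_ballP[/= r r0 rP]; change (is_true (0 < r :> R)) in r0.
set z0 := a + r / 2.
have z0E : f 0 z0 <= c - (c - f 0 a) / 2.
  have : ball a r z0.
    by rewrite /ball/= /z0 opprD addNKr normrN ger0_norm; lra.
  by move=> /rP; rewrite ltr_norml => /andP[]; lra.
have z00 : 0 <= z0 by rewrite /z0 addr_ge0 ?divr_ge0// ltW.
have p0 : 0 <= expm1_fun k z0 by rewrite -(expm1_fun0 k) expm1_fun_homo.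
(* Chosen so that the slope term at [z0], the largest point considered, costs at most half of the
   slack; the [+ 1] keeps the denominator positive. *)
pose delta := (c - f 0 a) / 2 / (expm1_fun k z0 + 1).
have d0 : 0 < delta by rewrite divr_gt0// ltr_wpDl.
have [eta1 eta10 eta1P] := mean_drawdown_fun_le0 d0.
exists delta, (Num.min eta1 (r / 2)); split.
- by rewrite lt_min eta10 divr_gt0.
- move=> z /andP[z1 z2]; apply: eta1P; rewrite z2 andbT (le_trans _ z1)//.
  by rewrite lerN2 ge_min lexx.
- move=> z /andP[z1 z2].
  have zz0 : z <= z0 by rewrite (le_trans z2)// lerD2l ge_min lexx orbT.
  rewrite (le_trans (mean_drawdown_fun_homo (ltW d0) z1 zz0))//.
  have -> : f delta z0 = f 0 z0 + delta * expm1_fun k z0.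
    by rewrite /mean_drawdown_fun mul0r addr0.
  have : delta * expm1_fun k z0 <= (c - f 0 a) / 2.
    by rewrite /delta mulrAC ler_pdivrMr ?ltr_wpDl// ler_pM2l// lerDl.
  lra.
Qed.

Lemma mean_drawdown_fun_rate : (f 0 a)^-1 = drawdown_rate sigma a mu.
Proof.
rewrite /mean_drawdown_fun mul0r addr0 /drawdown_rate /drawdown_rate_formula /expm2_fun.
have sn0 : sigma != 0 by rewrite gt_eqF.
have an0 : a != 0 by rewrite gt_eqF.
have -> : (k == 0) = (mu == 0).
  by rewrite !mulf_eq0 invr_eq0 sqrf_eq0 (negbTE sn0) orbF pnatr_eq0.
case: eqP => [_|/eqP mu0]; first by field; rewrite an0 sn0.
have -> : 2 * mu * a / sigma ^+ 2 = k * a by rewrite mulrAC.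
have := @expR_gt1Dx R (k * a); rewrite !mulf_neq0 ?invr_eq0 ?sqrf_eq0 ?pnatr_eq0// => /(_ isT) h.
set e := expR _ in h *.
(* In the inverses the exponential expression is a numerator, so that [field] only asks for [mu] and
   [sigma] to be nonzero. *)
rewrite -[LHS]invrK -[RHS]invrK; congr (_^-1); rewrite invrK invf_div; field.
by rewrite mu0 sn0.
Qed.

End mean_drawdown_fun_theory.

Lemma expm2_fun_near0 (R : realType) (k z : R) : 0 <= z ->
  `|expm2_fun k z - z ^+ 2 / 2| <= `|k| * (z ^+ 3 * expR (`|k| * z)).
Proof.
move=> z0; rewrite /expm2_fun; case: eqP => [->|/eqP k0].
  by rewrite subrr normr0 mul0r.
have := expR_taylor2 (k * z); rewrite normrM (ger0_norm z0) => h.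
have k2 : 0 < k ^+ 2 by rewrite exprn_even_gt0.
rewrite -(ler_pM2l k2) -[X in X * `|_| <= _](ger0_norm (ltW k2)) -normrM.
have -> : k ^+ 2 * ((expR (k * z) - 1 - k * z) / k ^+ 2 - z ^+ 2 / 2) =
  expR (k * z) - 1 - k * z - (k * z) ^+ 2 / 2 by field.
rewrite (le_trans h)// -(real_normK (num_real k)).
by rewrite le_eqVlt; apply/orP; left; apply/eqP; ring.
Qed.

Lemma drawdown_rate_formula_cvg (R : realType) (sigma a : R) : 0 < sigma -> 0 < a ->
  drawdown_rate_formula sigma a m @[m --> 0^'] --> sigma ^+ 2 / a ^+ 2.
Proof.
move=> s0 a0.
have s20 : 0 < 2 / sigma ^+ 2 by rewrite divr_gt0// exprn_gt0.
rewrite -[X in _ --> X]invrK invf_div.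
apply: (@cvg_trans _ ((mean_drawdown_fun m sigma 0 a)^-1 @[m --> 0^'])).
  apply: near_eq_cvg; near=> m.
  rewrite mean_drawdown_fun_rate// /drawdown_rate ifF//; apply/negbTE.
  by near: m; exact: nbhs_dnbhs_neq.
apply: cvgV; first by rewrite mulf_neq0 ?invr_eq0 ?expf_neq0 ?gt_eqF.
(* Lipschitz constant of [f 0 a] in the drift at 0, valid for [|m| <= 1]; one factor 2 / sigma^2
   comes from f and one from k. *)
pose C := (2 / sigma ^+ 2) ^+ 2 * (a ^+ 3 * expR (2 / sigma ^+ 2 * a)).
have C0 : 0 < C by rewrite mulr_gt0 ?exprn_gt0// mulr_gt0 ?exprn_gt0 ?expR_gt0.
apply/cvgrPdist_le => e e0; near=> m.
have m1 : `|m| <= 1.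
  near: m; apply: dnbhs0_le; exact: ltr01.
have me : `|m| <= e / C.
  near: m; apply: dnbhs0_le; exact: divr_gt0.
rewrite distrC /mean_drawdown_fun mul0r addr0.
have -> : 2 / sigma ^+ 2 * expm2_fun (2 * m / sigma ^+ 2) a - a ^+ 2 / sigma ^+ 2 =
    2 / sigma ^+ 2 * (expm2_fun (2 * m / sigma ^+ 2) a - a ^+ 2 / 2).
  by field; rewrite gt_eqF.
rewrite normrM (ger0_norm (ltW s20)).
have := expm2_fun_near0 (2 * m / sigma ^+ 2) (ltW a0).
have -> : 2 * m / sigma ^+ 2 = 2 / sigma ^+ 2 * m by rewrite mulrAC.
rewrite normrM (ger0_norm (ltW s20)) => h.
rewrite ler_pdivlMr// in me; apply: le_trans me.
rewrite (le_trans (ler_wpM2l (ltW s20) h))// /C.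
move: (2 / sigma ^+ 2) s20 => q s20.
rewrite [leRHS](_ : _ = q * (q * `|m| * (a ^+ 3 * expR (q * a)))); last by ring.
rewrite !ler_wpM2l ?mulr_ge0 ?exprn_ge0 ?(ltW s20) ?(ltW a0)//.
by rewrite ler_expR ler_wpM2r ?(ltW a0)// ler_piMr// ltW.
Unshelve. all: by end_near. Qed.

(** * The Gaussian identity for f and the variance of one step *)

Section mean_drawdown_fun_normal.
Variables (R : realType) (mu sigma : R).
Hypothesis sigma0 : 0 < sigma.

Lemma EFin_Rintegral d (T : measurableType d) (P : {measure set T -> \bar R}) (f : T -> R) :
  P.-integrable setT (EFin \o f) -> (\int[P]_x (f x)%:E = (\int[P]_x f x)%:E)%E.
Proof. by move=> fi; rewrite /Rintegral fineK// integrable_fin_num. Qed.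

Let integral_sqr_le d (T : measurableType d) (P : {measure set T -> \bar R}) (D Q : T -> R) :
  measurable_fun setT D -> P.-integrable setT (EFin \o Q) ->
  (forall x, D x ^+ 2 <= Q x) -> (\int[P]_x (D x ^+ 2)%:E <= (\int[P]_x Q x)%:E)%E.
Proof.
move=> mD Qi DQ; rewrite -EFin_Rintegral//; apply: ge0_le_integral => //.
- by move=> x _; rewrite lee_fin sqr_ge0.
- by apply/measurable_EFinP; exact: measurable_funX.
- exact: measurable_int Qi.
- by move=> x _; rewrite lee_fin.
Qed.

Let integrable_cst1 (s : R) : (normal_prob 0 s).-integrable setT (EFin \o (fun=> 1 : R)).
Proof. exact: finite_measure_integrable_cst. Qed.

Let Rintegral_cst1 (s : R) : \int[normal_prob 0 s]_x (1 : R) = 1.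
Proof. by rewrite Rintegral_cst// mul1r [X in fine X]probability_setT. Qed.

(** Here f(z) = z^2 / sigma^2 + delta z, so the compensated step is c x + x^2 - h, centered because
    the second moment of x is h. Its square is at most 2 c^2 x^2 + 4 x^4 + 4 h^2, and h^2 <= h makes
    this linear in h; 192 is 4 times 48. *)
Let driftless (delta b : R) : mu = 0 -> exists C : R, forall h y : R, 0 < h <= 1 -> 0 <= y <= b ->
  (\int[normal_prob 0 (Num.sqrt h)]_x (mean_drawdown_fun mu sigma delta
     (y - (mu * h + sigma * x)) - mean_drawdown_fun mu sigma delta y - h)%:E = 0 /\
   \int[normal_prob 0 (Num.sqrt h)]_x ((mean_drawdown_fun mu sigma delta
     (y - (mu * h + sigma * x)) - mean_drawdown_fun mu sigma delta y - h) ^+ 2)%:E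
     <= (C * h)%:E)%E.
Proof.
move=> mu0; exists (2 * (2 * b / sigma + `|delta| * sigma) ^+ 2 + 192 * expR 1 + 4).
move=> h y /andP[h0 h1] /andP[y0 yb].
set s := Num.sqrt h; have s0 : 0 < s by rewrite sqrtr_gt0.
have s2 : s ^+ 2 = h by rewrite sqr_sqrtr// ltW.
have sn0 : sigma != 0 by rewrite gt_eqF.
have j0 := integrable_cst1 s.
have j1 : (normal_prob 0 s).-integrable setT (EFin \o (fun x => x)).
  exact: (integrable_normal_exprn s0 0).
have j4 : (normal_prob 0 s).-integrable setT (EFin \o (fun x => x ^+ 4)).
  exact: (integrable_normal_exprn s0 3).
pose c := - (2 * y / sigma + delta * sigma).
have DE x : mean_drawdown_fun mu sigma delta (y - (mu * h + sigma * x)) -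
    mean_drawdown_fun mu sigma delta y - h = c * x + x ^+ 2 - h * 1.
  rewrite /mean_drawdown_fun /expm1_fun /expm2_fun mu0 !mulr0 !mul0r !eqxx.
  by rewrite /c; field.
have i1 : (normal_prob 0 s).-integrable setT (EFin \o (fun x => c * x)).
  exact: (integrableZl measurableT c (integrable_normal_exprn s0 0)).
have i2 : (normal_prob 0 s).-integrable setT (EFin \o (fun x => x ^+ 2)).
  exact: (integrable_normal_exprn s0 1).
have i12 : (normal_prob 0 s).-integrable setT (EFin \o (fun x => c * x + x ^+ 2)).
  exact: (integrableD measurableT i1 i2).
have i0 : (normal_prob 0 s).-integrable setT (EFin \o (fun x : R => h * 1)).
  exact: (integrableZl measurableT h (integrable_cst1 s)).
have iD : (normal_prob 0 s).-integrable setT (EFin \o (fun x => c * x + x ^+ 2 - h * 1)).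
  exact: (integrableB measurableT i12 i0).
split.
  under eq_integral do rewrite DE.
  rewrite EFin_Rintegral// RintegralB//.
  rewrite RintegralD// RintegralZl//.
  rewrite RintegralZl// (Rintegral_cst1 s) normal_mean// normal_second_moment//.
  by rewrite s2 mulr0 add0r mulr1 subrr.
under eq_integral do rewrite DE.
have i4 : (normal_prob 0 s).-integrable setT (EFin \o (fun x => 4 * x ^+ 4)).
  exact: (integrableZl measurableT 4 (integrable_normal_exprn s0 3)).
have i2c : (normal_prob 0 s).-integrable setT (EFin \o (fun x => 2 * c ^+ 2 * x ^+ 2)).
  exact: (integrableZl measurableT (2 * c ^+ 2) i2).
have ih : (normal_prob 0 s).-integrable setT (EFin \o (fun x : R => 4 * h ^+ 2 * 1)).
  exact: (integrableZl measurableT (4 * h ^+ 2) (integrable_cst1 s)).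
have i24 : (normal_prob 0 s).-integrable setT (EFin \o (fun x => 2 * c ^+ 2 * x ^+ 2 + 4 * x ^+ 4)).
  exact: (integrableD measurableT i2c i4).
have iQ : (normal_prob 0 s).-integrable setT
    (EFin \o (fun x => 2 * c ^+ 2 * x ^+ 2 + 4 * x ^+ 4 + 4 * h ^+ 2 * 1)).
  exact: (integrableD measurableT i24 ih).
apply: le_trans (integral_sqr_le _ iQ _) _.
- by apply/measurable_EFinP; exact: measurable_int iD.
- move=> x; have := sqr_ge0 (c * x - (x ^+ 2 - h)); have := sqr_ge0 (x ^+ 2 + h).
  by rewrite !expr2; lra.
rewrite lee_fin RintegralD//.
rewrite RintegralD// RintegralZl// RintegralZl//.
rewrite RintegralZl// (Rintegral_cst1 s) normal_second_moment// s2 mulr1.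
have h4 := normal_fourth_moment_le s0.
rewrite (_ : s ^+ 4 = h * h) in h4; last by rewrite -s2; ring.
have hh : h * h <= h by rewrite ler_piMl// ltW.
have cb : c ^+ 2 <= (2 * b / sigma + `|delta| * sigma) ^+ 2.
  rewrite -(real_normK (num_real c)) ler_sqr ?nnegrE//; last first.
    by rewrite addr_ge0 ?mulr_ge0 ?invr_ge0 ?(ltW sigma0)// (le_trans y0).
  rewrite /c normrN (le_trans (ler_normD _ _))// lerD//.
    rewrite ger0_norm ?mulr_ge0 ?invr_ge0 ?(ltW sigma0)//.
    by rewrite ler_pM2r ?invr_gt0// ler_pM2l.
  by rewrite normrM (ger0_norm (ltW sigma0)).
have e1 := expR_ge0 (1 : R).
have h4' := le_trans h4 (ler_wpM2l (_ : 0 <= 48 * expR 1) hh).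
have {h4'}h4 : \int[normal_prob 0 s]_x (x ^+ 4) <= 48 * expR 1 * h.
  by apply: h4'; rewrite mulr_ge0.
have := ler_wpM2r (ltW h0) cb; rewrite [h ^+ 2]expr2; lra.
Qed.

(** Here f(z) is alpha exp(k z) - z / mu up to a constant. The linear part produces exactly the
    compensator h, and k is the exponent for which exp(- k X) is a martingale, which is the identity
    [gl]. The exponential part has variance A^2 (exp(l^2 h) - 1), linear in h for h <= 1. *)
Let drifted (delta b : R) : mu != 0 -> exists C : R, forall h y : R, 0 < h <= 1 -> 0 <= y <= b ->
  (\int[normal_prob 0 (Num.sqrt h)]_x (mean_drawdown_fun mu sigma delta
     (y - (mu * h + sigma * x)) - mean_drawdown_fun mu sigma delta y - h)%:E = 0 /\
   \int[normal_prob 0 (Num.sqrt h)]_x ((mean_drawdown_fun mu sigma delta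
     (y - (mu * h + sigma * x)) - mean_drawdown_fun mu sigma delta y - h) ^+ 2)%:E
     <= (C * h)%:E)%E.
Proof.
move=> mu0; set k := 2 * mu / sigma ^+ 2.
have sn0 : sigma != 0 by rewrite gt_eqF.
have k0 : k != 0 by rewrite !mulf_neq0 ?invr_eq0 ?expf_neq0 ?pnatr_eq0.
pose alpha := sigma ^+ 2 / (2 * mu ^+ 2) + delta / k.
pose l := - k * sigma.
exists (2 * (alpha * expR (`|k| * b)) ^+ 2 * (l ^+ 2 * expR (l ^+ 2)) + 2 * (sigma / mu) ^+ 2).
move=> h y /andP[h0 h1] /andP[y0 yb].
set s := Num.sqrt h; have s0 : 0 < s by rewrite sqrtr_gt0.
have s2 : s ^+ 2 = h by rewrite sqr_sqrtr// ltW.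
have j0 := integrable_cst1 s.
have j1 : (normal_prob 0 s).-integrable setT (EFin \o (fun x => x)).
  exact: (integrable_normal_exprn s0 0).
pose A := alpha * expR (k * y).
pose g := expR (- k * mu * h).
have DE x : mean_drawdown_fun mu sigma delta (y - (mu * h + sigma * x)) -
    mean_drawdown_fun mu sigma delta y - h =
    A * (g * expR (l * x) - 1) + sigma / mu * x.
  rewrite /mean_drawdown_fun /expm1_fun /expm2_fun -/k (negbTE k0) /A /g /l.
  have -> : expR (k * (y - (mu * h + sigma * x))) =
      expR (k * y) * (expR (- k * mu * h) * expR (- k * sigma * x)).
    by rewrite -!expRD; congr expR; ring.
  move: (expR (k * y)) (expR (- k * mu * h)) (expR (- k * sigma * x)) => e1 e2 e3.
  by rewrite /alpha /k; field; rewrite sn0 mu0.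
have gl : g * expR (l ^+ 2 * h / 2) = 1.
  rewrite -expRD (_ : _ + _ = 0) ?expR0// /l /k; field.
  by rewrite sn0.
have iex (j : R) : (normal_prob 0 s).-integrable setT (EFin \o (fun x => expR (j * x))).
  exact: integrable_normal_exp.
have Eex (j : R) : \int[normal_prob 0 s]_x (expR (j * x)) = expR (j ^+ 2 * h / 2).
  by rewrite /Rintegral normal_mgf// s2.
have igex : (normal_prob 0 s).-integrable setT (EFin \o (fun x => g * expR (l * x))).
  exact: (integrableZl measurableT g (iex l)).
have igex1 : (normal_prob 0 s).-integrable setT (EFin \o (fun x => g * expR (l * x) - 1)).
  exact: (integrableB measurableT igex (integrable_cst1 s)).
have iA : (normal_prob 0 s).-integrable setT (EFin \o (fun x => A * (g * expR (l * x) - 1))).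
  exact: (integrableZl measurableT A igex1).
have ix : (normal_prob 0 s).-integrable setT (EFin \o (fun x => sigma / mu * x)).
  exact: (integrableZl measurableT (sigma / mu) (integrable_normal_exprn s0 0)).
have iD : (normal_prob 0 s).-integrable setT
    (EFin \o (fun x => A * (g * expR (l * x) - 1) + sigma / mu * x)).
  exact: (integrableD measurableT iA ix).
split.
  under eq_integral do rewrite DE.
  rewrite EFin_Rintegral// RintegralD// RintegralZl//.
  rewrite RintegralZl//.
  rewrite normal_mean// mulr0 addr0 RintegralB// RintegralZl// Eex gl (Rintegral_cst1 s).
  by rewrite subrr mulr0.
under eq_integral do rewrite DE.
have i2 : (normal_prob 0 s).-integrable setT (EFin \o (fun x => x ^+ 2)).
  exact: (integrable_normal_exprn s0 1).
have iq2 : (normal_prob 0 s).-integrable setT (EFin \o (fun x => 2 * (sigma / mu) ^+ 2 * x ^+ 2)).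
  exact: (integrableZl measurableT (2 * (sigma / mu) ^+ 2) i2).
have ie2 : (normal_prob 0 s).-integrable setT
    (EFin \o (fun x => 2 * A ^+ 2 * g ^+ 2 * expR (2 * l * x))).
  exact: (integrableZl measurableT (2 * A ^+ 2 * g ^+ 2) (iex (2 * l))).
have ie1 : (normal_prob 0 s).-integrable setT
    (EFin \o (fun x => 4 * A ^+ 2 * g * expR (l * x))).
  exact: (integrableZl measurableT (4 * A ^+ 2 * g) (iex l)).
have ie0 : (normal_prob 0 s).-integrable setT (EFin \o (fun x : R => 2 * A ^+ 2 * 1)).
  exact: (integrableZl measurableT (2 * A ^+ 2) (integrable_cst1 s)).
have ie21 : (normal_prob 0 s).-integrable setT (EFin \o (fun x =>
    2 * A ^+ 2 * g ^+ 2 * expR (2 * l * x) - 4 * A ^+ 2 * g * expR (l * x))).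
  exact: (integrableB measurableT ie2 ie1).
have ie210 : (normal_prob 0 s).-integrable setT (EFin \o (fun x =>
    2 * A ^+ 2 * g ^+ 2 * expR (2 * l * x) - 4 * A ^+ 2 * g * expR (l * x) + 2 * A ^+ 2 * 1)).
  exact: (integrableD measurableT ie21 ie0).
have iQ : (normal_prob 0 s).-integrable setT (EFin \o (fun x =>
    2 * A ^+ 2 * g ^+ 2 * expR (2 * l * x) - 4 * A ^+ 2 * g * expR (l * x) + 2 * A ^+ 2 * 1 +
    2 * (sigma / mu) ^+ 2 * x ^+ 2)).
  exact: (integrableD measurableT ie210 iq2).
apply: le_trans (integral_sqr_le _ iQ _) _.
- by apply/measurable_EFinP; exact: measurable_int iD.
- move=> x; rewrite (_ : 2 * l * x = l * x + l * x); last by ring.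
  rewrite expRD; set e := expR (l * x).
  by have := sqr_ge0 (A * (g * e - 1) - sigma / mu * x); rewrite !expr2; lra.
rewrite lee_fin RintegralD// RintegralD// RintegralB// !RintegralZl// !Eex.
rewrite (Rintegral_cst1 s) normal_second_moment// s2.
have -> : (2 * l) ^+ 2 * h / 2 = l ^+ 2 * h / 2 + l ^+ 2 * h / 2 + l ^+ 2 * h.
  by field.
rewrite !expRD; set e := expR (l ^+ 2 * h / 2) in gl *.
have -> : 2 * A ^+ 2 * g ^+ 2 * (e * e * expR (l ^+ 2 * h)) - 4 * A ^+ 2 * g * e + 2 * A ^+ 2 * 1 =
    2 * A ^+ 2 * (expR (l ^+ 2 * h) - 1).
  rewrite [LHS](_ : _ = 2 * A ^+ 2 * ((g * e) ^+ 2 * expR (l ^+ 2 * h) - 2 * (g * e) + 1)).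
    by rewrite gl; ring.
  by ring.
rewrite [leRHS]mulrDl lerD// -[leRHS]mulrA.
have l2h : 0 <= l ^+ 2 * h by rewrite mulr_ge0 ?sqr_ge0 ?(ltW h0).
apply: ler_pM.
- by rewrite mulr_ge0 ?sqr_ge0.
- exact: expR_sub1_ge0.
-
  rewrite ler_pM2l// /A -(real_normK (num_real (alpha * expR (k * y)))).
  rewrite -[leRHS](real_normK (num_real _)) ler_sqr ?nnegrE// !(normrM alpha) ler_wpM2l//.
  rewrite !(ger0_norm (expR_ge0 _)) ler_expR (le_trans (ler_norm _))// (normrM k) (ger0_norm y0).
  by rewrite ler_wpM2l.
rewrite (le_trans (expR_sub1_le _))// mulrAC ler_wpM2r ?(ltW h0)//.
rewrite ler_wpM2l ?sqr_ge0// ler_expR ler_piMr ?sqr_ge0//.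
Qed.

(* As f solves (sigma^2 / 2) f'' - mu f' = 1 on the whole line, the identity is
   exact for every mesh h. *)
Lemma mean_drawdown_fun_normal (delta b : R) :
  exists C : R, forall h y : R, 0 < h <= 1 -> 0 <= y <= b ->
  (\int[normal_prob 0 (Num.sqrt h)]_x (mean_drawdown_fun mu sigma delta
     (y - (mu * h + sigma * x)) - mean_drawdown_fun mu sigma delta y - h)%:E = 0 /\
   \int[normal_prob 0 (Num.sqrt h)]_x ((mean_drawdown_fun mu sigma delta
     (y - (mu * h + sigma * x)) - mean_drawdown_fun mu sigma delta y - h) ^+ 2)%:E
     <= (C * h)%:E)%E.
Proof. by case: (eqVneq mu 0) => [/driftless|/drifted]; apply. Qed.

End mean_drawdown_fun_normal.

(** * Brownian increments *)

Lemma integral_equal_law d d' (T : measurableType d) (U : measurableType d') (R : realType)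
    (P : probability T R) (nu : probability U R) (X : T -> U) (g : U -> \bar R) :
  measurable_fun setT X -> (forall A, measurable A -> P (X @^-1` A) = nu A) ->
  measurable_fun setT g -> (\int[P]_w g (X w) = \int[nu]_x g x)%E.
Proof.
move=> mX lawX mg.
have ge0 (f : U -> \bar R) : measurable_fun setT f -> (forall x, 0 <= f x)%E ->
    (\int[P]_w f (X w) = \int[nu]_x f x)%E.
  move=> mf f0; pose X' : {mfun T >-> U} := mfun_Sub (mem_set mX).
  rewrite -(ge0_integral_distribution (P := P) X')//.
  by apply: eq_measure_integral => A mA _; exact: lawX.
rewrite [LHS]integralE [RHS]integralE; congr (_ - _)%E.
- under eq_integral do rewrite (_ : (fun w => g (X w)) = g \o X)// funepos_comp.
  by apply: (ge0 (g^\+)%E) => //; exact: measurable_funepos.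
- under eq_integral do rewrite (_ : (fun w => g (X w)) = g \o X)// funeneg_comp.
  by apply: (ge0 (g^\-)%E) => //; exact: measurable_funeneg.
Qed.

Lemma measurable_drawdown_step (R : realType) (b : R) :
  measurable_fun setT (fun z : (R * nat) * R => drawdown_step b z.1 z.2).
Proof.
have m1 : measurable_fun setT (fun z : (R * nat) * R => z.1.1 - z.2).
  by apply: measurable_funB => //; exact: measurableT_comp.
have m2 : measurable_fun setT (fun z : (R * nat) * R => z.1.2).
  exact: measurableT_comp.
apply: measurable_fun_ifT.
- exact: measurable_fun_ler.
- apply: measurable_fun_pair => //.
  by apply: (measurableT_comp (f := succn) _ m2).
- by apply: measurable_fun_pair => //; exact: measurable_maxr.
Qed.

Section brownian_grid.
Variables (R : realType) (d : measure_display) (T : measurableType d)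
  (P : probability T R) (W : R -> {RV P >-> R}) (x0 mu sigma : R).
Hypotheses (BW : standard_brownian_motion W) (sigma0 : 0 < sigma).
Let X (w : T) : R -> R := drifted_path x0 mu sigma (fun t => W t w).
Variable h : R.
Hypothesis h0 : 0 < h.
Let xi (j : nat) (w : T) : R := grid_increment (X w) h j.
Let dW (j : nat) (w : T) : R := W (j.+1%:R * h) w - W (j%:R * h) w.

Let xiE j w : xi j w = mu * h + sigma * dW j w.
Proof.
rewrite /xi /grid_increment /X /drifted_path /dW -natr1.
by ring.
Qed.

Let mdW j : measurable_fun setT (dW j).
Proof. exact: measurable_funB. Qed.

Lemma measurable_grid_increment j : measurable_fun setT (fun w => grid_increment (X w) h j).
Proof.
rewrite (_ : (fun w => _) = fun w => mu * h + sigma * dW j w); last first.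
  by apply/funext => w; exact: xiE.
by apply: measurable_funD => //; exact: measurable_funM.
Qed.

Let dW_law j A : measurable A -> P (dW j @^-1` A) = normal_prob 0 (Num.sqrt h) A.
Proof.
move=> mA.
have -> : h = j.+1%:R * h - j%:R * h by rewrite -natr1 mulrDl mul1r addrAC subrr add0r.
apply: (brownian_gaussian BW) => //; first by rewrite mulr_ge0// ltW.
by rewrite ltr_pM2r// ltr_nat.
Qed.

Lemma integral_grid_increment (g : R -> R) j : measurable_fun setT g ->
  (\int[P]_w (g (grid_increment (X w) h j))%:E =
   \int[normal_prob 0 (Num.sqrt h)]_x (g (mu * h + sigma * x))%:E)%E.
Proof.
move=> mg; under eq_integral do rewrite -/(xi j _) xiE.
have := @integral_equal_law _ _ _ _ R P (normal_prob 0 (Num.sqrt h)) (dW j)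
  (fun x => (g (mu * h + sigma * x))%:E) (mdW j).
apply; first by move=> A mA; exact: dW_law.
apply/measurable_EFinP; apply: (measurableT_comp mg).
by apply: measurable_funD => //; exact: measurable_funM.
Qed.

Lemma grid_increment_independent n (A : nat -> set R) : (forall i, measurable (A i)) ->
  P (\bigcap_(i in `I_n) (fun w => grid_increment (X w) h i) @^-1` A i) =
  (\prod_(i < n) P ((fun w => grid_increment (X w) h i) @^-1` A i))%E.
Proof.
move=> mA; pose B (i : nat) := (fun x : R => mu * h + sigma * x) @^-1` A i.
have mlin : measurable_fun setT (fun x : R => mu * h + sigma * x).
  by apply: measurable_funD => //; exact: measurable_funM.
have mB i : measurable (B i) by rewrite -[B i]setTI; exact: mlin.
have pre i : (fun w => grid_increment (X w) h i) @^-1` A i = dW i @^-1` B i.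
  by apply/seteqP; split=> w; rewrite /B /= -/(xi i w) xiE.
have := brownian_independent BW (n := n) (t := fun i => i%:R * h).
rewrite mul0r => /(_ (lexx 0)) H.
have nd : nondecreasing_seq (fun i : nat => i%:R * h).
  by move=> i j ij; rewrite ler_pM2r// ler_nat.
have := H nd (fun i : 'I_n => B i) (fun i => mB i).
rewrite (eq_bigr (fun i : 'I_n => P (dW i @^-1` B i)))// => HH.
rewrite (eq_bigr (fun i : 'I_n => P (dW i @^-1` B i))); last by move=> i _; rewrite pre.
rewrite -HH; congr (P _); apply/seteqP; split => w /= Hw.
  by move=> i _; have := Hw i (ltn_ord i); rewrite /= -/(xi i w) xiE.
by move=> i /= ni; have := Hw (Ordinal ni) I; rewrite /= /B /= -/(xi i w) xiE.
Qed.

Variables (b delta : R) (v : nat -> R).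
Hypotheses (b0 : 0 < b) (v01 : forall n, 0 <= v n <= 1).
Let f := mean_drawdown_fun mu sigma delta.

Definition compensated_sum (n : nat) (w : T) : R :=
  \sum_(j < n) compensated_increment h f v
    (drawdown_chain b (grid_increment (X w) h) j) (grid_increment (X w) h j).

(** The Gaussian estimates hold only for states in [0, b], while the abstract theory asks for them
    at every state. Clamping extends them and leaves the chain alone, since it stays in this
    interval. *)
Let clamp (y : R) : R := Num.max 0 (Num.min y b).

Let D (z : (R * nat) * R) : R := compensated_increment h f v (clamp z.1.1, z.1.2) z.2.

Let mf : measurable_fun setT f.
Proof. by apply: continuous_measurable_fun; exact: continuous_mean_drawdown_fun. Qed.

Let mD : measurable_fun setT D.
Proof.
have m11 : measurable_fun setT (fun z : (R * nat) * R => z.1.1) by exact: measurableT_comp.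
have m12 : measurable_fun setT (fun z : (R * nat) * R => z.1.2) by exact: measurableT_comp.
have mc : measurable_fun setT (fun z : (R * nat) * R => clamp z.1.1).
  by apply: measurable_maxr => //; exact: measurable_minr.
apply: measurable_funM => /=; first by apply: (measurableT_comp (f := v) _ m12).
apply: measurable_funB => //; apply: measurable_funB.
  by apply: (measurableT_comp mf); exact: measurable_funB.
exact: measurableT_comp.
Qed.

Let chainE n w : driven_chain (fun z => drawdown_step b z.1 z.2) (0, 0%N) xi n w =
  drawdown_chain b (grid_increment (X w) h) n.
Proof. by elim: n => [//|n ih] /=; rewrite ih. Qed.

Let sumE n : driven_sum (fun z => drawdown_step b z.1 z.2) (0, 0%N) xi D n = compensated_sum n.
Proof.
apply/funext => w; apply: eq_bigr => j _; rewrite chainE /D /=.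
have /andP[Y0 Yb] := drawdown_chain_bounds (grid_increment (X w) h) b0 j.
by rewrite /clamp min_l ?(ltW Yb)// max_r//; case: (drawdown_chain _ _ _).
Qed.

Variable C : R.
Hypothesis f_normal : forall y : R, 0 <= y <= b ->
  (\int[normal_prob 0 (Num.sqrt h)]_x (f (y - (mu * h + sigma * x)) - f y - h)%:E = 0 /\
   \int[normal_prob 0 (Num.sqrt h)]_x ((f (y - (mu * h + sigma * x)) - f y - h) ^+ 2)%:E
     <= (C * h)%:E)%E.

Let clamp_bounds y : 0 <= clamp y <= b.
Proof. by rewrite /clamp le_max lexx/= ge_max (ltW b0) ge_min lexx orbT. Qed.

Let mincr (y : R) : measurable_fun setT (fun x : R => f (y - x) - f y - h).
Proof.
apply: measurable_funB => //; apply: measurable_funB => //.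
by apply: (measurableT_comp mf); exact: measurable_funB.
Qed.

Let D_centered j s : (\int[P]_w (D (s, xi j w))%:E = 0)%E.
Proof.
case: s => y n; have [E0 E2] := f_normal (clamp_bounds y).
have mnu : measurable_fun setT (fun x : R => mu * h + sigma * x).
  by apply: measurable_funD => //; exact: measurable_funM.
have m2 := measurableT_comp (mincr (clamp y)) mnu.
rewrite /D /compensated_increment /=.
rewrite (@integral_grid_increment
  (fun x => v n * (f (clamp y - x) - f (clamp y) - h)) j)//; last first.
  exact: measurable_funM.
under eq_integral do rewrite EFinM.
rewrite integralZl// ?E0 ?mule0//.
have i2 := @integrable_sqr_le _ _ R (normal_prob 0 (Num.sqrt h)) _ _ m2 E2.
exact: (@integrable_of_sqr _ _ R (normal_prob 0 (Num.sqrt h)) _ m2 i2).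
Qed.

Let D_sqr j s : (\int[P]_w (D (s, xi j w) ^+ 2)%:E <= (C * h)%:E)%E.
Proof.
case: s => y n; have [E0 E2] := f_normal (clamp_bounds y).
rewrite /D /compensated_increment /=.
rewrite (@integral_grid_increment
  (fun x => (v n * (f (clamp y - x) - f (clamp y) - h)) ^+ 2) j)//; last first.
  by apply: measurable_funX; exact: measurable_funM.
have mnu : measurable_fun setT (fun x : R => mu * h + sigma * x).
  by apply: measurable_funD => //; exact: measurable_funM.
have m2 := measurableT_comp (mincr (clamp y)) mnu.
apply: le_trans E2; apply: ge0_le_integral => //.
- by move=> x _; rewrite lee_fin sqr_ge0.
- by apply/measurable_EFinP; apply: measurable_funX; exact: measurable_funM.
- by apply/measurable_EFinP; apply: measurable_funX.
- move=> x _; rewrite lee_fin exprMn ler_piMl ?sqr_ge0//.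
  by have /andP[? ?] := v01 n; rewrite expr_le1.
Qed.

Let mstep := @measurable_drawdown_step R b.

Lemma measurable_compensated_sum n : measurable_fun setT (compensated_sum n).
Proof.
by rewrite -sumE; apply: measurable_driven_sum => //; exact: measurable_grid_increment.
Qed.

Lemma compensated_sum_sqr n : (\int[P]_w (compensated_sum n w ^+ 2)%:E <= (n%:R * (C * h))%:E)%E.
Proof.
rewrite -sumE; apply: driven_sum_sqr => //.
- exact: measurable_grid_increment.
- exact: grid_increment_independent.
Qed.

Lemma integrable_compensated_sum n : P.-integrable setT (fun w => (compensated_sum n w)%:E).
Proof.
rewrite -sumE; exact: (integrable_driven_sum (0 : R, 0%N) mstep measurable_grid_increment
  grid_increment_independent mD D_centered D_sqr).
Qed.

Lemma compensated_sum_centered n : (\int[P]_w (compensated_sum n w)%:E = 0)%E.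
Proof.
rewrite -sumE; exact: (driven_sum_centered (0 : R, 0%N) mstep measurable_grid_increment
  grid_increment_independent mD D_centered D_sqr).
Qed.

Lemma measurable_chain_count n :
  measurable_fun setT (fun w => (drawdown_chain b (grid_increment (X w) h) n).2).
Proof.
have := measurable_driven_chain (0 : R, 0%N) mstep measurable_grid_increment n.
move=> /measurable_fun_pairP[_]; congr (measurable_fun _ _).
by apply/funext => w /=; rewrite chainE.
Qed.

End brownian_grid.

(** * Almost sure and mean limits *)

(* Paths are continuous only almost surely, so a drawdown time need not be
   measurable; its integral is a supremum over simple functions below it. *)
Section nonmeasurable_integral.
Context d (T : measurableType d) (R : realType) (P : probability T R).
Local Open Scope ereal_scope.
Import HBNNSimple.

Lemma ge0_le_integral_nomeas (f g : T -> \bar R) : (forall x, 0 <= f x) ->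
  (forall x, f x <= g x) -> \int[P]_x f x <= \int[P]_x g x.
Proof.
move=> f0 fg; rewrite !ge0_integralTE//; last by move=> x; exact: le_trans (fg x).
by apply: le_ereal_sup => _ [h hf <-]; exists h => // x; exact: le_trans (fg x).
Qed.

(** The simple functions that define the integral are bounded. The integer bound [m] later serves as
    the time horizon of the grid. *)
Lemma ge0_integral_le_bounded (f : T -> \bar R) (c : \bar R) : (forall x, 0 <= f x) ->
  (forall (g : T -> R) (m : nat), measurable_fun setT g -> (forall x, 0 <= g x <= m%:R)%R ->
    (forall x, (g x)%:E <= f x) -> \int[P]_x (g x)%:E <= c) ->
  \int[P]_x f x <= c.
Proof.
move=> f0 fc; rewrite ge0_integralTE//; apply: ge_ereal_sup => _ [h hf <-].
rewrite -integralT_nnsfun.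
have [M [Mreal hM]] := simple_bounded h.
have hM1 x : (h x <= M + 1)%R.
  by rewrite (le_trans (ler_norm _))// hM// ltrDl.
apply: (fc _ (Num.truncn (M + 1)).+1) => // x.
by rewrite fun_ge0/= (le_trans (hM1 x))// ltW// truncnS_gt.
Qed.

(** Fatou applied to [M - t k] shows that the upper limit of the [t k], which is [g], has integral
    at least [L]. It is measurable and almost everywhere below [f], so [f] itself may fail to be
    measurable. *)
Lemma integral_ge_of_limsup (t : nat -> T -> R) (M L : R) (f : T -> \bar R) :
  (forall k, measurable_fun setT (t k)) -> (forall k x, 0 <= t k x <= M)%R ->
  (forall k, L%:E <= \int[P]_x (t k x)%:E) -> (forall x, 0 <= f x) ->
  {ae P, forall x, exists K, forall k, (K <= k)%N -> (t k x)%:E <= f x} ->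
  L%:E <= \int[P]_x f x.
Proof.
move=> mt tM Lt f0 [N [mN N0 fN]].
pose u k x := (M - t k x)%:E.
have mu k : measurable_fun setT (u k).
  by apply/measurable_EFinP; exact: measurable_funB.
have u0 k x : 0 <= u k x by rewrite lee_fin subr_ge0; have /andP[] := tM k x.
have uM k x : u k x <= M%:E by rewrite lee_fin gerBl; have /andP[] := tM k x.
pose U x := limn_einf (u^~ x).
have limUB (v : nat -> \bar R) (c : \bar R) : (forall k, v k <= c) -> limn_einf v <= c.
  move=> vc; rewrite limn_einf_lim; apply: lime_le; first exact: is_cvg_einfs.
  by apply: nearW => k; apply: le_trans (vc k); apply: ereal_inf_lbound; exists k => /=.
have U0 x : 0 <= U x.
  rewrite /U limn_einf_lim; apply: lime_ge; first exact: is_cvg_einfs.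
  by apply: nearW => k; apply: le_ereal_inf_tmp => _ [j /= _ <-].
have UM x : U x <= M%:E by apply: limUB.
have mU : measurable_fun setT U.
  rewrite (_ : U = fun x => - limn_esup (fun k => - u k x)); last first.
    by apply/funext => x; rewrite -[RHS]/(- limn_esup (-%E \o (u^~ x))) limn_esupN oppeK.
  apply: measurableT_comp => //; apply: measurable_fun_limn_esup => k.
  exact: measurableT_comp.
have Ufin x : U x \is a fin_num.
  by rewrite ge0_fin_numE// (le_lt_trans (UM x))// ltry.
pose g x := M%:E - U x.
have mg : measurable_fun setT g by exact: emeasurable_funB.
have g0 x : 0 <= g x.
  by rewrite /g; move: (UM x) (Ufin x); case: (U x) => // r; rewrite -EFinB !lee_fin subr_ge0.
have Lg : L%:E <= \int[P]_x g x.
  have UL : \int[P]_x U x <= (M - L)%:E.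
    apply: (le_trans (@fatou _ _ _ P setT measurableT u mu (fun k x _ => u0 k x))).
    apply: limUB => k; rewrite /u.
    have it : P.-integrable setT (EFin \o t k).
      apply: measurable_bounded_integrable => //.
        by rewrite (le_lt_trans (probability_le1 _ _))// ltry.
      exists M; split; first exact: num_real.
      move=> y My x _ /=; rewrite ger0_norm; have /andP[t0 t1] := tM k x => //.
      by rewrite (le_trans t1)// ltW.
    under eq_integral do rewrite EFinB.
    rewrite integralB//; last exact: finite_measure_integrable_cst.
    rewrite integral_cst//= probability_setT mule1 EFinB leeB//.
  have : \int[P]_x U x + \int[P]_x g x = M%:E.
    rewrite -ge0_integralD//.
    under eq_integral do rewrite /g addeC subeK//.
    by rewrite integral_cst//= probability_setT mule1.
  have ifin : \int[P]_x U x \is a fin_num.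
    rewrite ge0_fin_numE ?integral_ge0// (le_lt_trans UL)// ltry//.
  move: UL ifin; case: (\int[P]_x U x) => // r rL _.
  case: (\int[P]_x g x) => // s.
  by move: rL; rewrite -EFinD !lee_fin => rL [E]; clear -rL E; lra.
apply: (le_trans Lg).
rewrite (ge0_negligible_integral mN)// integral_mkcond.
apply: ge0_le_integral_nomeas => x; rewrite patchE.
  by case: ifP => // _; exact: g0.
case: ifPn => [|_]; last exact: f0.
rewrite inE => -[_ Nx].
have [K Kf] : exists K, forall k, (K <= k)%N -> (t k x)%:E <= f x.
  by apply: contrapT => H; apply: Nx; exact: fN.
have fK := le_trans _ (Kf K (leqnn K)).
case E : (f x) => [r| |]; rewrite ?leey//; last by have := f0 x; rewrite E.
suff : (M - r)%:E <= U x.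
  rewrite /g; move: (Ufin x); case: (U x) => // s _.
  by rewrite -EFinB !lee_fin; clear; lra.
rewrite /U limn_einf_lim; apply: lime_ge; first exact: is_cvg_einfs.
exists K => // n /= Kn; apply: le_ereal_inf_tmp => _ [j /= nj <-].
rewrite /u lee_fin lerD2l lerN2 -lee_fin -E; apply: Kf.
exact: leq_trans nj.
Qed.

End nonmeasurable_integral.

(** * Borel-Cantelli along square times, for a sequence of meshes *)

Section borel_cantelli_sqr.
Context d (T : measurableType d) (R : realType) (P : probability T R).
Local Open Scope ereal_scope.

Lemma markov_sqr (Z : T -> R) (e v : R) : measurable_fun setT Z -> (0 < e)%R ->
  \int[P]_x (Z x ^+ 2)%:E <= v%:E -> P [set x | (e <= `|Z x|)%R] <= (v / e ^+ 2)%:E.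
Proof.
move=> mZ e0 Zv; set A := [set x | _].
have mA : measurable A.
  rewrite -[A]setTI; apply: measurable_fun_le => //.
  exact: measurableT_comp.
have e2 : (0 < e ^+ 2)%R by rewrite exprn_gt0.
have mI : measurable_fun setT (fun x => (\1_A x : R)%:E).
  by apply/measurable_EFinP; exact: measurable_indic.
rewrite EFinM lee_pdivlMr// muleC.
apply: le_trans Zv.
have -> : (e ^+ 2)%:E * P A = \int[P]_x ((e ^+ 2)%:E * (\1_A x)%:E).
  rewrite ge0_integralZl//; first by rewrite integral_indic// setIT.
  by rewrite lee_fin ltW.
apply: ge0_le_integral => //.
- by move=> x _; rewrite -EFinM lee_fin mulr_ge0// ltW.
- exact: measurable_funeM.
- by apply/measurable_EFinP; exact: measurable_funX.
- move=> x _; rewrite -EFinM lee_fin indicE.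
  have [xA|_] := boolP (x \in A); last by rewrite mulr0 sqr_ge0.
  rewrite mulr1 -[leRHS](real_normK (num_real _)) ler_sqr ?nnegrE ?(ltW e0)//.
  by move: xA; rewrite inE.
Qed.

(** [B i] is the event that the sum is large for all large [k]. It is an increasing union of
    intersections, each inside a single [A i k], so the Chebyshev bound for one [k] passes to [B i]
    without any joint control of the meshes. *)
Lemma ae_frequently_small (Z : nat -> nat -> T -> R) (C e : R) :
  (forall m k, measurable_fun setT (Z m k)) -> (0 <= C)%R -> (0 < e)%R ->
  (forall m k, \int[P]_x (Z m k x ^+ 2)%:E <= (m%:R * C)%:E) ->
  {ae P, forall x, exists I, forall i, (I <= i)%N -> forall K, exists2 k, (K <= k)%N &
     (`|Z (i.+1 ^ 2)%N k x| < e * (i.+1 ^ 2)%:R)%R}.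
Proof.
move=> mZ C0 e0 ZC.
pose A i k := [set x | (e * (i.+1 ^ 2)%:R <= `|Z (i.+1 ^ 2)%N k x|)%R].
have mA i k : measurable (A i k).
  rewrite -[A i k]setTI; apply: measurable_fun_le => //.
  exact: measurableT_comp.
pose B i := \bigcup_K \bigcap_(k in [set k | (K <= k)%N]) A i k.
have mBK i K : measurable (\bigcap_(k in [set k | (K <= k)%N]) A i k).
  exact: bigcap_measurableType.
have mB i : measurable (B i) by exact: bigcupT_measurable.
pose c : R := (C / e ^+ 2)%R.
have c0 : (0 <= c)%R by rewrite divr_ge0// sqr_ge0.
(* Chebyshev at m = (i + 1)^2 gives c / (i + 1)^2; the inequality 1 / j^2 <= 2 / (j (j + 1)) turns
   this into a telescoping sum. *)
have PB i : P (B i) <= (2 * c / i.+1%:R - 2 * c / i.+2%:R)%:E.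
  have i1 : (0 < i.+1%:R :> R)%R by rewrite ltr0n.
  have i2 : (0 < i.+2%:R :> R)%R by rewrite ltr0n.
  have PA k : P (A i k) <= (2 * c / i.+1%:R - 2 * c / i.+2%:R)%:E.
    have ei : (0 < e * (i.+1 ^ 2)%:R)%R by rewrite mulr_gt0// ltr0n expn_gt0.
    apply: (le_trans (markov_sqr (mZ _ _) ei (ZC _ _))).
    rewrite lee_fin natrX.
    have -> : (i.+1%:R ^+ 2 * C / (e * i.+1%:R ^+ 2) ^+ 2 = c / i.+1%:R ^+ 2 :> R)%R.
      by rewrite /c; field; rewrite !gt_eqF.
    have -> : (2 * c / i.+1%:R - 2 * c / i.+2%:R = c / i.+1%:R * (2 / i.+2%:R) :> R)%R.
      rewrite -(natr1 i.+1); move: (i.+1%:R : R)%R i1 => j j0; field.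
      by rewrite !gt_eqF// addr_gt0.
    rewrite expr2 invfM mulrA ler_wpM2l ?(divr_ge0 c0) ?(ltW i1)//.
    rewrite ler_pdivlMr// mulrC ler_pdivrMr// -!natrM ler_nat.
    by rewrite mul2n -addnn addSn addnS !ltnS leq_addl.
  have /cvg_lim <- // : P (\bigcap_(k in [set k | (K <= k)%N]) A i k) @[K --> \oo] --> P (B i).
    apply: nondecreasing_cvg_mu; [exact: mBK|exact: mB|].
    move=> K L KL; apply/subsetPset => x h k /= Lk; apply: h => /=; exact: leq_trans Lk.
  apply: lime_le.
    apply: ereal_nondecreasing_is_cvgn => K L KL; apply: le_measure; rewrite ?inE//.
    by move=> x h k /= Lk; apply: h => /=; exact: leq_trans Lk.
  apply: nearW => K; apply: le_trans (PA K).
  by apply: le_measure; rewrite ?inE// => x; apply => /=.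
have lim0 : P (lim_sup_set B) = 0.
  apply: lim_sup_set_cvg0 => //.
  apply: (@le_lt_trans _ _ (2 * c)%:E); last exact: ltry.
  apply: lime_le; first by apply: is_cvg_nneseries.
  apply: nearW => n.
  apply: (@le_trans _ _ (\sum_(0 <= i < n) (2 * c / i.+1%:R - 2 * c / i.+2%:R)%:E)).
    by apply: lee_sum => i _; exact: PB.
  rewrite sumEFin lee_fin.
  have -> : (\sum_(0 <= i < n) (2 * c / i.+1%:R - 2 * c / i.+2%:R) =
      2 * c - 2 * c / n.+1%:R :> R)%R.
    elim: n => [|n ih]; first by rewrite big_nil divr1 subrr.
    by rewrite big_nat_recr//= ih; ring.
  by rewrite gerBl divr_ge0// mulr_ge0.
exists (lim_sup_set B); split => //.
  apply: bigcap_measurableType => // n _; exact: bigcup_measurable.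
move=> x /= Hx n _; apply: contrapT => HB; apply: Hx.
exists n => i ni K; apply: contrapT => HK; apply: HB.
exists i => //; exists K => // k /= Kk.
rewrite /A /= leNgt; apply/negP => lt; apply: HK; exists k => //.
Qed.

End borel_cantelli_sqr.

(** * From square times to all times *)

Section drawdown_count_theory.
Variables (R : realType) (a : R) (x : R -> R).
Notation tau := (drawdown_time a x).
Notation count := (drawdown_count a x).

Let summand_ge0 t n : (0 <= ((tau n <= t%:E)%E)%:R%:E :> \bar R)%E.
Proof. by rewrite lee_fin. Qed.

Lemma drawdown_count_ge n t : (tau n <= t%:E)%E -> (n%:R%:E <= count t)%E.
Proof.
move=> nt; rewrite /drawdown_count.
apply: le_trans (nneseries_lim_ge n.+1 _) => //.
rewrite (eq_big_nat _ _ (F2 := fun=> 1%:E)); last first.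
  by move=> i /andP[_ ni]; rewrite (le_trans (drawdown_time_homo _ _ _) nt).
by rewrite sumEFin lee_fin sumr_const_nat subn1.
Qed.

Lemma drawdown_count_le t (B : R) : 0 <= t ->
  (forall n, (tau n <= t%:E)%E -> n%:R <= B) -> (count t <= B%:E)%E.
Proof.
move=> t0 tB; apply: lime_le; first exact: is_cvg_nneseries.
apply: nearW => M.
suff [n nt nM] : exists2 n, (tau n <= t%:E)%E &
    (\sum_(1 <= i < M) ((tau i <= t%:E)%E)%:R%:E <= n%:R%:E :> \bar R)%E.
  by rewrite (le_trans nM)// lee_fin tB.
elim: M => [|M [n nt nM]]; first by exists 0%N; rewrite ?big_geq// lee_fin.
case: (posnP M) => [->|M0]; first by exists 0%N; rewrite ?big_geq// lee_fin.
have [Mt|Mt] := boolP (tau M <= t%:E)%E.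
  exists M => //; rewrite sumEFin lee_fin.
  rewrite (@le_trans _ _ (\sum_(1 <= i < M.+1) 1))//; last first.
    by rewrite sumr_const_nat subn1.
  by apply: ler_sum => i _; case: (tau i <= _)%E.
by exists n => //; rewrite big_nat_recr//= (negbTE Mt) adde0.
Qed.

(* The epsilons are taken of the form 1 / (q + 5) so that they are countably
   many and at most 1/5. *)
Lemma drawdown_count_cvg (c : R) : 0 < c ->
  (forall q, exists I, forall i, (I <= i)%N -> forall n, (tau n <= (i.+1 ^ 2)%:R%:E)%E ->
    c * (1 - q.+4.+1%:R^-1) * n%:R <= (1 + q.+4.+1%:R^-1) * (i.+1 ^ 2)%:R) ->
  (forall q, exists I, forall i, (I <= i)%N -> exists2 n, (tau n <= (i.+1 ^ 2)%:R%:E)%E &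
    (1 - q.+4.+1%:R^-1) * (i.+1 ^ 2)%:R - 2 * c <= c * (1 + q.+4.+1%:R^-1) * n%:R) ->
  (count t / t%:E)%E @[t --> +oo] --> (c^-1)%:E.
Proof.
move=> c0 Hup Hlow.
have key e : 0 < e -> \forall t \near +oo,
    exists2 r : R, (count t / t%:E)%E = r%:E & `|c^-1 - r| <= e.
  move=> e0.
  pose q := (Num.truncn (6 / c / e)).
  pose eps : R := q.+4.+1%:R^-1.
  have eps0 : 0 < eps by rewrite invr_gt0 ltr0n.
  have eps5 : eps <= 1 / 5 by rewrite div1r lef_pV2 ?posrE// ler_nat.
  have epse : 6 * eps / c <= e.
    have : 6 / c / e < q.+1%:R by exact: truncnS_gt.
    rewrite ltr_pdivrMr// => h.
    have h2 : 6 / c <= e * q.+4.+1%:R.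
      rewrite (le_trans (ltW h))// mulrC ler_pM2l// ler_nat.
      by rewrite -[q.+4.+1]/(4 + q.+1)%N leq_addl.
    by rewrite mulrAC /eps ler_pdivrMr// ltr0n.
  have [I1 H1] := Hup q; have [I2 H2] := Hlow q.
  rewrite -/eps in H1 H2.
  (* Beyond [M] both hypotheses apply, (i + 1)^2 <= (1 + eps) i^2 follows from [3 <= eps * i], and
     the boundary term [2 * c] is absorbed by [eps * i]. *)
  pose M := (I1 + I2 + (Num.truncn (3 / eps)).+1 + (Num.truncn (2 * c / eps)).+1)%N.
  near=> t.
  have tM : (M.+1%:R ^+ 2 : R) <= t by near: t; exact: nbhs_pinfty_ge.
  have t0 : 0 < t by rewrite (lt_le_trans _ tM)// exprn_gt0.
  pose i := Num.truncn (Num.sqrt t).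
  have /andP[i1 i2] := truncn_itv (sqrtr_ge0 t); rewrite -/i in i1 i2.
  have st : Num.sqrt t ^+ 2 = t by rewrite sqr_sqrtr// ltW.
  have it : i%:R ^+ 2 <= t by rewrite -st ler_sqr ?nnegrE ?sqrtr_ge0.
  have ti : t <= i.+1%:R ^+ 2 by rewrite -st ler_sqr ?nnegrE ?sqrtr_ge0// ltW.
  have Mi : (M < i)%N.
    have : M.+1%:R <= Num.sqrt t.
      by rewrite -(@ler_sqr _ _ (Num.sqrt t)) ?nnegrE ?sqrtr_ge0// st.
    by move=> /le_lt_trans/(_ i2); rewrite ltr_nat ltnS.
  have i0 : (0 < i)%N by exact: leq_ltn_trans Mi.
  have iR1 : 1 <= i%:R :> R by rewrite ler1n.
  have i3 : 3 <= eps * i%:R.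
    have : 3 / eps < (Num.truncn (3 / eps)).+1%:R by exact: truncnS_gt.
    rewrite ltr_pdivrMr// [_ * eps]mulrC => /ltW/le_trans; apply; rewrite ler_pM2l// ler_nat.
    by rewrite (leq_trans _ (ltnW Mi))// /M -addnA addnCA leq_addr.
  have ic : 2 * c <= eps * i%:R.
    have : 2 * c / eps < (Num.truncn (2 * c / eps)).+1%:R by exact: truncnS_gt.
    rewrite ltr_pdivrMr// [_ * eps]mulrC => /ltW/le_trans; apply; rewrite ler_pM2l// ler_nat.
    by rewrite (leq_trans _ (ltnW Mi))// /M leq_addl.
  have ii : i.+1%:R ^+ 2 <= (1 + eps) * i%:R ^+ 2 :> R.
    rewrite -natr1; move: (i%:R : R) iR1 i3 => j j1 j3.
    have := ler_wpM2r (le_trans ler01 j1) j3; rewrite !expr2; lra.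
  have up : (count t <= ((1 + 6 * eps) / c * t)%:E)%E.
    apply: drawdown_count_le (ltW t0) _ => n nt.
    have nti : (tau n <= (i.+1 ^ 2)%:R%:E)%E.
      by rewrite (le_trans nt)// lee_fin natrX.
    have I1i : (I1 <= i)%N by rewrite (leq_trans _ (ltnW Mi))// /M -!addnA leq_addr.
    have := H1 i I1i n nti; rewrite natrX => h.
    have h2 : c * (1 - eps) * n%:R <= (1 + eps) * ((1 + eps) * t).
      rewrite (le_trans h)// ler_pM2l; last by lra.
      by rewrite (le_trans ii)// ler_pM2l//; lra.
    have e1 : 0 < 1 - eps by lra.
    have h3 : (1 + eps) * ((1 + eps) * t) <= (1 + 6 * eps) * (1 - eps) * t.
      by rewrite mulrA ler_pM2r//; nra.
    have h4 : c * n%:R <= (1 + 6 * eps) * t.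
      rewrite -(ler_pM2r e1) mulrAC (le_trans h2)// (le_trans h3)//.
      by rewrite mulrAC.
    by rewrite mulrAC ler_pdivlMr// mulrC.
  have low : (((1 - 6 * eps) / c * t)%:E <= count t)%E.
    (* The lower hypothesis is taken at [i.-1], that is at time i^2 <= t, the upper one at [i], that
       is at time (i + 1)^2 >= t. *)
    have I2i : (I2 <= i.-1)%N.
      by rewrite -ltnS prednK// (leq_trans _ Mi)// ltnS /M -!addnA addnCA leq_addr.
    have [n nt] := H2 _ I2i; rewrite prednK// natrX in nt *; move=> h.
    have nt' : (tau n <= t%:E)%E by rewrite (le_trans nt)// lee_fin.
    apply: le_trans (drawdown_count_ge nt'); rewrite lee_fin.
    have ic2 : 2 * c <= eps * i%:R ^+ 2.
      by rewrite (le_trans ic)// expr2 ler_pM2l// ler_peMl// (le_trans ler01).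
    have h2 : (1 - 2 * eps) * i%:R ^+ 2 <= c * (1 + eps) * n%:R by lra.
    have e1 : 0 < 1 + eps by lra.
    have h3 : (1 - 2 * eps) * t <= c * (1 + eps) * n%:R * (1 + eps).
      have := ler_wpM2r (ltW e1) h2; apply: le_trans.
      rewrite -mulrA ler_wpM2l//; first by lra.
      by rewrite mulrC (le_trans ti).
    have h4 : (1 - 6 * eps) * t * ((1 + eps) * (1 + eps)) <= (1 - 2 * eps) * t.
      by rewrite mulrAC ler_pM2r//; nra.
    have h5 : (1 - 6 * eps) * t <= c * n%:R.
      rewrite -(ler_pM2r (mulr_gt0 e1 e1)) (le_trans h4)// (le_trans h3)//.
      by rewrite le_eqVlt; apply/orP; left; apply/eqP; ring.
    by rewrite mulrAC ler_pdivrMr// [_ * c]mulrC.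
  move: up low; case: (count t) => // r; rewrite !lee_fin => up low.
  exists (r / t); first by rewrite inver gt_eqF// EFinM.
  rewrite ler_norml; apply/andP; split.
    have : r / t <= (1 + 6 * eps) / c by rewrite ler_pdivrMr.
    by move: epse; rewrite !mulrDl; lra.
  have : (1 - 6 * eps) / c <= r / t by rewrite ler_pdivlMr.
  by move: epse; rewrite !mulrDl mulNr; lra.
apply/fine_cvgP; split.
  near=> t; have [r -> //] : exists2 r : R, (count t / t%:E)%E = r%:E & `|c^-1 - r| <= 1.
  by near: t; exact: (key 1 ltr01).
apply/cvgrPdist_le => e e0; near=> t.
have [r /= -> //] : exists2 r : R, (count t / t%:E)%E = r%:E & `|c^-1 - r| <= e.
  by near: t; exact: key.
Unshelve. all: by end_near. Qed.

End drawdown_count_theory.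

Lemma mesh_lt (R : realType) (e : R) : 0 < e ->
  exists K, forall k, (K <= k)%N -> 0 < (k.+1%:R^-1 : R) < e.
Proof.
move=> e0; exists (Num.truncn e^-1) => k Kk.
rewrite invr_gt0 ltr0n/= invf_plt ?posrE//.
by rewrite (lt_le_trans (truncnS_gt _))// ler_nat ltnS.
Qed.

(** * Deterministic bounds on grids of mesh 1 / (k + 1) *)

Section grid_paths.
Variables (R : realType) (x : R -> R) (a : R).
Hypothesis cx : {within `[0, +oo[, continuous x}.
Notation tau := (drawdown_time a x).
Notation xi k := (grid_increment x k.+1%:R^-1).

Lemma grid_increment_small (m : nat) (eta : R) : 0 < eta ->
  exists K, forall k, (K <= k)%N -> forall j, (j < m * k.+1)%N -> `|xi k j| <= eta.
Proof.
move=> eta0; have [d d0 dP] := within_continuous_unif m%:R cx eta0.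
have [K KP] := mesh_lt d0; exists K => k /KP /andP[h0 hd] j jm.
have jm' (i : nat) : (i <= m * k.+1)%N -> 0 <= (i%:R / k.+1%:R : R) <= m%:R.
  by move=> im; rewrite divr_ge0//= ler_pdivrMr ?ltr0n// -natrM ler_nat.
rewrite ltW// /grid_increment; apply: dP; rewrite ?jm' ?(ltnW jm)//.
by rewrite -natr1 mulrDl mul1r addrAC subrr add0r gtr0_norm.
Qed.

Lemma drawdown_chain_count_ge_grid (b : R) (m : nat) : 0 < b < a ->
  exists K, forall k, (K <= k)%N -> forall (n : nat) (t : R), tau n = t%:E -> t <= m%:R ->
    exists i, [/\ (i <= m * k.+1)%N, i%:R / k.+1%:R <= t & (n <= (drawdown_chain b (xi k) i).2)%N].
Proof.
move=> ba; have [d d0 dP] := drawdown_chain_count_ge m%:R cx ba.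
have [K KP] := mesh_lt d0; exists K => k /KP h0d n t taut tm.
have t0 : 0 <= t by rewrite -lee_fin -taut drawdown_time_ge0.
have k0 : 0 < k.+1%:R :> R by rewrite ltr0n.
have fl : (Num.truncn (t / k.+1%:R^-1))%:R <= t * k.+1%:R.
  by rewrite invrK truncn_le mulr_ge0.
exists (Num.truncn (t / k.+1%:R^-1)); split.
- rewrite -(ler_nat R) (le_trans fl)// natrM ler_pM2r//.
- by rewrite ler_pdivrMr.
- exact: dP.
Qed.

Variables (f : R -> R) (c eps : R) (m : nat).
Hypotheses (f0 : f 0 = 0) (c0 : 0 < c).

Let potential1 s : chain_potential f (fun=> 1) c s = c * s.2%:R + f s.1.
Proof. by rewrite /chain_potential mul1r sumr_const card_ord. Qed.

Let steps k : k.+1%:R^-1 * (\sum_(j < m * k.+1) 1) = m%:R :> R.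
Proof. by rewrite sumr_const card_ord natrM mulrC mulfK. Qed.

Let sum1 b k : R := \sum_(j < m * k.+1)
  compensated_increment k.+1%:R^-1 f (fun=> 1) (drawdown_chain b (xi k) j) (xi k j).

(** The comparison of counts holds for all large [k] and the sum is small for arbitrarily large [k];
    one common [k] suffices. The term f(Y) is dropped by its sign. *)
Lemma grid_path_upper (b : R) : 0 < b < a ->
  (forall z, 0 <= f z) -> (forall z, b <= z -> c <= f z) ->
  (forall K, exists2 k, (K <= k)%N & `|sum1 b k| < eps * m%:R) ->
  forall n, (tau n <= m%:R%:E)%E -> c * n%:R <= (1 + eps) * m%:R.
Proof.
move=> ba fge0 fc freq n nm.
have [t taut] : exists t, tau n = t%:E.
  by move: nm (drawdown_time_ge0 x a n); case: (tau n) => // r _ _; exists r.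
rewrite taut lee_fin in nm.
have [K KP] := drawdown_chain_count_ge_grid m ba.
have [k /KP/(_ n t taut nm)[i [im _ ni]] small] := freq K.
have := compensated_sum_ge k.+1%:R^-1 (xi k) (fun _ : nat => ler01) f0 (m * k.+1) fge0 fc.
rewrite potential1 steps -/(sum1 b k) => h.
have cn : c * n%:R <= c * (drawdown_chain b (xi k) (m * k.+1)).2%:R.
  by rewrite ler_pM2l// ler_nat (leq_trans ni)// drawdown_chain_count_homo.
have := fge0 (drawdown_chain b (xi k) (m * k.+1)).1.
by move: small; rewrite ltr_norml => /andP[_]; lra.
Qed.

Lemma grid_path_lower (eta : R) : 0 < a -> 0 < eta ->
  (forall z, - eta <= z <= 0 -> f z <= 0) -> (forall z, 0 <= z <= a + eta -> f z <= c) ->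
  (forall K, exists2 k, (K <= k)%N & `|sum1 a k| < eps * m%:R) ->
  exists2 n, (tau n <= m%:R%:E)%E & (1 - eps) * m%:R - c <= c * n%:R.
Proof.
move=> a0 eta0 fle0 fc freq.
have [K KP] := grid_increment_small m eta0.
have [k /KP xik small] := freq K.
have fc' z : a <= z <= a + eta -> f z <= c.
  by move=> /andP[az zae]; rewrite fc// zae andbT (le_trans (ltW a0)).
have := compensated_sum_le k.+1%:R^-1 a0 (fun _ : nat => ler01) f0 fle0 fc' xik.
rewrite potential1 steps -/(sum1 a k) => h.
(* The grid count at level [a] itself serves as [n], since it never exceeds the true count; f(Y) is
   at most [c], whence the term [- c]. *)
exists (drawdown_chain a (xi k) (m * k.+1)).2.
  have k0 : 0 < (k.+1%:R^-1 : R) by rewrite invr_gt0 ltr0n.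
  rewrite (le_trans (drawdown_time_chain_le x a k0 _))// lee_fin natrM mulfK//.
have /andP[Y0 Ya] := drawdown_chain_bounds (xi k) a0 (m * k.+1).
have : f (drawdown_chain a (xi k) (m * k.+1)).1 <= c.
  by rewrite fc// Y0 (le_trans (ltW Ya))// lerDl ltW.
by move: small; rewrite ltr_norml => /andP[]; lra.
Qed.

Let weight0 (n : nat) : R := (n == 0%N)%:R.

Let sum0 b k : R := \sum_(j < m * k.+1)
  compensated_increment k.+1%:R^-1 f weight0 (drawdown_chain b (xi k) j) (xi k j).

Let first b k : R := chain_first_time b k.+1%:R^-1 (xi k) (m * k.+1).

Let firstE b k : k.+1%:R^-1 *
  (\sum_(j < m * k.+1) weight0 (drawdown_chain b (xi k) j).2) = first b k.
Proof. by []. Qed.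

Let weight0_ge0 n : 0 <= weight0 n. Proof. by rewrite /weight0. Qed.

Let potential0 s : chain_potential f weight0 c s = if s.2 == 0%N then f s.1 else c.
Proof.
rewrite /chain_potential /weight0; case: s => y [|n] /=.
  by rewrite big_ord0 mulr0 add0r mul1r.
rewrite mul0r addr0 big_ord_recl/= big1 ?addr0 ?mulr1// => i _.
Qed.

(** If nothing is counted by time [m], the potential is only known to be nonnegative instead of [c].
    Then the capped time equals [m], so the extra [c / m%:R] times it makes up for exactly [c], at a
    relative cost that vanishes as [m] grows. *)
Lemma first_time_lower_bound (b : R) k : 0 < b -> (0 < m)%N ->
  (forall z, 0 <= f z) -> (forall z, b <= z -> c <= f z) ->
  c <= sum0 b k + (1 + c / m%:R) * first b k.
Proof.
move=> b0 m0 fge0 fc.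
have := compensated_sum_ge k.+1%:R^-1 (xi k) weight0_ge0 f0 (m * k.+1) fge0 fc.
rewrite potential0 firstE -/(sum0 b k).
have k0 : 0 < (k.+1%:R^-1 : R) by rewrite invr_gt0 ltr0n.
have mR : 0 < m%:R :> R by rewrite ltr0n.
have T0 : 0 <= first b k by exact: chain_first_time_ge0.
have cT : 0 <= c / m%:R * first b k by rewrite mulr_ge0// divr_ge0// ltW.
case: eqP => [N0|_]; last by lra.
have -> : first b k = m%:R.
  by rewrite /first chain_first_time_eq// natrM mulfK.
have := fge0 (drawdown_chain b (xi k) (m * k.+1)).1.
by rewrite mulrDl mul1r divfK ?gt_eqF//; lra.
Qed.

Lemma first_time_upper_bound (eta : R) k : 0 < a -> 0 < eta ->
  (forall z, - eta <= z <= 0 -> f z <= 0) -> (forall z, 0 <= z <= a + eta -> f z <= c) ->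
  (forall j, (j < m * k.+1)%N -> `|xi k j| <= eta) -> first a k <= c - sum0 a k.
Proof.
move=> a0 eta0 fle0 fc xik.
have fc' z : a <= z <= a + eta -> f z <= c.
  by move=> /andP[az zae]; rewrite fc// zae andbT (le_trans (ltW a0)).
have := compensated_sum_le k.+1%:R^-1 a0 weight0_ge0 f0 fle0 fc' xik.
rewrite potential0 firstE -/(sum0 a k) => h.
have /andP[Y0 Ya] := drawdown_chain_bounds (xi k) a0 (m * k.+1).
have : f (drawdown_chain a (xi k) (m * k.+1)).1 <= c.
  by rewrite fc// Y0 (le_trans (ltW Ya))// lerDl ltW.
by move: h; case: ifP => _; lra.
Qed.

End grid_paths.

Lemma drawdown_time1_le_grid (R : realType) (x : R -> R) (a r : R) (m k : nat) :
  (r%:E <= drawdown_time a x 1)%E -> r <= m%:R ->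
  r <= chain_first_time a k.+1%:R^-1 (grid_increment x k.+1%:R^-1) (m * k.+1).
Proof.
move=> rtau rm.
have k0 : 0 < (k.+1%:R^-1 : R) by rewrite invr_gt0 ltr0n.
case: (posnP (drawdown_chain a (grid_increment x k.+1%:R^-1) (m * k.+1)).2) => [N0|N1].
  by rewrite chain_first_time_eq// natrM mulfK.
by rewrite -lee_fin (le_trans rtau)// drawdown_time1_le_first_time.
Qed.

Lemma first_time_le_drawdown_time1 (R : realType) (x : R -> R) (a b : R) (m : nat) :
  {within `[0, +oo[, continuous x} -> 0 < b < a ->
  exists K, forall k, (K <= k)%N ->
  ((chain_first_time b k.+1%:R^-1 (grid_increment x k.+1%:R^-1) (m * k.+1))%:E <=
    drawdown_time a x 1)%E.
Proof.
move=> cx ba; have [K KP] := drawdown_chain_count_ge_grid cx m ba.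
exists K => k Kk.
have k0 : 0 < (k.+1%:R^-1 : R) by rewrite invr_gt0 ltr0n.
have Tm : chain_first_time b k.+1%:R^-1 (grid_increment x k.+1%:R^-1) (m * k.+1) <= m%:R.
  by rewrite (le_trans (chain_first_time_le _ _ _ _))// natrM mulfK.
case: (leP m%:R%:E (drawdown_time a x 1)) => tm.
  by rewrite (le_trans _ tm)// lee_fin.
have [t taut] : exists t, drawdown_time a x 1 = t%:E.
  by move: tm (drawdown_time_ge0 x a 1); case: (drawdown_time a x 1) => // r _ _; exists r.
rewrite taut lte_fin in tm.
have [i [_ it N1]] := KP k Kk 1%N t taut (ltW tm).
rewrite taut lee_fin; apply: le_trans it; exact: chain_first_time_le_hit.
Qed.

(** * The count and the mean first drawdown time of Brownian motion with drift *)

Section brownian_drawdowns.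
Variables (R : realType) (d : measure_display) (T : measurableType d)
  (P : probability T R) (W : R -> {RV P >-> R}) (x0 mu sigma a : R).
Hypotheses (BW : standard_brownian_motion W) (sigma0 : 0 < sigma) (a0 : 0 < a).
Let X (w : T) : R -> R := drifted_path x0 mu sigma (fun t => W t w).
Notation tau w := (drawdown_time a (X w)).
Let f := mean_drawdown_fun mu sigma.
Let c := f 0 a.
Notation mesh k := (k.+1%:R^-1 : R).
Notation xi k w := (grid_increment (X w) (mesh k)).

Let c0 : 0 < c. Proof. exact: mean_drawdown_fun_gt0. Qed.

Let mesh_gt0 k : 0 < mesh k. Proof. by rewrite invr_gt0 ltr0n. Qed.

Let mesh_le1 k : mesh k <= 1. Proof. by rewrite invf_le1 ?ltr0n// ler1n. Qed.

Let continuous_paths : {ae P, forall w, {within `[0, +oo[, continuous (X w)}}.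
Proof.
have caff : continuous (fun t : R => x0 + mu * t).
  by move=> u; apply: cvgD; [exact: cvg_cst|apply: cvgM; [exact: cvg_cst|exact: cvg_id]].
have cA : {within `[0, +oo[, continuous (fun t : R => x0 + mu * t)}.
  exact: continuous_subspaceT.
have := brownian_continuous BW; apply: filterS => w cW t.
apply: cvgD; last by apply: cvgM; [exact: cvg_cst|exact: cW].
exact: cA.
Qed.

Let csum b delta v m k w := compensated_sum W x0 mu sigma (mesh k) b delta v (m * k.+1) w.

(** There are m (k + 1) steps of variance at most C / (k + 1) each, so the bound does not depend on
    the mesh. *)
Let csum_sqr (b delta C : R) (v : nat -> R) m k : 0 < b -> (forall n, 0 <= v n <= 1) ->
  (forall h y : R, 0 < h <= 1 -> 0 <= y <= b ->
  (\int[normal_prob 0 (Num.sqrt h)]_x (f delta (y - (mu * h + sigma * x)) - f delta y - h)%:E = 0 /\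
   \int[normal_prob 0 (Num.sqrt h)]_x ((f delta (y - (mu * h + sigma * x)) - f delta y - h) ^+ 2)%:E
     <= (C * h)%:E)%E) ->
  (\int[P]_w (csum b delta v m k w ^+ 2)%:E <= (m%:R * `|C|)%:E)%E.
Proof.
move=> b0 v01 hC.
have hC' y (yb : 0 <= y <= b) := hC (mesh k) y (introT andP (conj (mesh_gt0 k) (mesh_le1 k))) yb.
apply: (le_trans (compensated_sum_sqr x0 BW (mesh_gt0 k) b0 v01 hC' (m * k.+1))).
by rewrite lee_fin natrM mulrCA mulfK// mulrC ler_wpM2l// ler_norm.
Qed.

Let ones01 (n : nat) : 0 <= (1 : R) <= 1. Proof. by rewrite ler01 lexx. Qed.

Let frequently_small (b delta e : R) : 0 < b -> 0 < e ->
  {ae P, forall w, exists I, forall i, (I <= i)%N -> forall K, exists2 k, (K <= k)%N &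
     `|csum b delta (fun=> 1) (i.+1 ^ 2)%N k w| < e * (i.+1 ^ 2)%:R}.
Proof.
move=> b0 e0; have [C hC] := mean_drawdown_fun_normal mu sigma0 delta b.
apply: (ae_frequently_small (C := `|C|)) => // [m k|m k].
  exact: measurable_compensated_sum.
exact: csum_sqr ones01 hC.
Qed.

Lemma drawdown_count_cvg_ae : {ae P, forall w,
  (drawdown_count a (X w) t / t%:E)%E @[t --> +oo] --> (c^-1)%:E}.
Proof.
pose e q : R := q.+4.+1%:R^-1.
have e0 q : 0 < e q by rewrite invr_gt0 ltr0n.
have e1 q : e q < 1 by rewrite invf_lt1 ?ltr0n// ltr1n.
have Hup q : {ae P, forall w, exists I, forall i, (I <= i)%N -> forall n,
    (tau w n <= (i.+1 ^ 2)%:R%:E)%E -> c * (1 - e q) * n%:R <= (1 + e q) * (i.+1 ^ 2)%:R}.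
  have c'c : c * (1 - e q) < c by rewrite gtr_pMr// gtrBl.
  have c'0 : 0 < c * (1 - e q) by rewrite mulr_gt0// subr_gt0.
  have [b ba fc] := mean_drawdown_fun_lower sigma0 a0 c'c.
  have b0 : 0 < b by case/andP: ba.
  apply: filterS2 continuous_paths (frequently_small 0 b0 (e0 q)) => w cw [I HI].
  exists I => i Ii.
  apply: (grid_path_upper cw (mean_drawdown_fun0 mu sigma 0) c'0 ba _ fc (HI i Ii)).
  exact: mean_drawdown_fun_ge0.
have Hlow q : {ae P, forall w, exists I, forall i, (I <= i)%N ->
    exists2 n, (tau w n <= (i.+1 ^ 2)%:R%:E)%E &
    (1 - e q) * (i.+1 ^ 2)%:R - 2 * c <= c * (1 + e q) * n%:R}.
  have cc' : c < c * (1 + e q) by rewrite ltr_pMr// ltrDl.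
  have c'0 : 0 < c * (1 + e q) by exact: lt_trans cc'.
  have [delta [eta [eta0 fle0 fc]]] := mean_drawdown_fun_upper sigma0 a0 cc'.
  apply: filterS2 continuous_paths (frequently_small delta a0 (e0 q)) => w cw [I HI].
  exists I => i Ii.
  have [n nt nc] := grid_path_lower cw (mean_drawdown_fun0 mu sigma delta)
    a0 eta0 fle0 fc (HI i Ii).
  (* The boundary term c (1 + e q) is at most 2 c because e q < 1. *)
  exists n => //; apply: le_trans nc; rewrite lerD2l lerN2 mulrC ler_pM2r//.
  by have := e1 q; lra.
apply: filterS2 (ae_foralln Hup) (ae_foralln Hlow) => w up low.
exact: drawdown_count_cvg.
Qed.

Let tau1_ge0 w : (0 <= tau w 1)%E. Proof. exact: drawdown_time_ge0. Qed.

Let weight0 (n : nat) : R := (n == 0%N)%:R.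

Let weight01 n : 0 <= weight0 n <= 1.
Proof. by rewrite /weight0 ler0n; case: (n == 0%N); rewrite ?lexx ?ler01. Qed.

Let first b m k w : R := chain_first_time b (mesh k) (xi k w) (m * k.+1).

Let measurable_first b m k : 0 < b -> measurable_fun setT (first b m k).
Proof.
move=> b0; apply: measurable_funM => //; apply: measurable_sum => j.
apply: (measurableT_comp (f := weight0) (T2 := nat)) => //.
exact: measurable_chain_count.
Qed.

Let first_bounds b m k w : 0 <= first b m k w <= m%:R.
Proof.
rewrite /first; apply/andP; split; first exact: chain_first_time_ge0.
by rewrite (le_trans (chain_first_time_le _ _ _ _))// natrM mulfK.
Qed.

(** Integrating the path inequality removes the centered sum and bounds the mean of the capped grid
    time from below for every mesh. Along almost every path these times are eventually at most the
    true one. *)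
Let mean_tau1_ge_bound (c' : R) (m : nat) : 0 < c' -> c' < c -> (0 < m)%N ->
  ((c' / (1 + c' / m%:R))%:E <= \int[P]_w tau w 1)%E.
Proof.
move=> c'0 c'c m0.
have [b ba fc] := mean_drawdown_fun_lower sigma0 a0 c'c.
have b0 : 0 < b by case/andP: ba.
have q0 : 0 < 1 + c' / m%:R by rewrite ltr_wpDr// divr_ge0// ltW.
have [C hC] := mean_drawdown_fun_normal mu sigma0 0 b.
apply: (@integral_ge_of_limsup _ _ _ _ (first b m) m%:R) => //.
- by move=> k; exact: measurable_first.
- move=> k.
  have hC' y (yb : 0 <= y <= b) := hC (mesh k) y (introT andP (conj (mesh_gt0 k) (mesh_le1 k))) yb.
  have iS := integrable_compensated_sum x0 BW (mesh_gt0 k) b0 weight01 hC' (m * k.+1).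
  have iT : P.-integrable setT (fun w => (first b m k w)%:E).
    apply: measurable_bounded_integrable => //.
    + by rewrite (le_lt_trans (probability_le1 _ _))// ltry.
    + exact: measurable_first.
    + exists m%:R; split; first exact: num_real.
      move=> y my w _ /=; have /andP[t0 t1] := first_bounds b m k w.
      by rewrite ger0_norm// (le_trans t1)// ltW.
  have iqT : P.-integrable setT (fun w => ((1 + c' / m%:R)%:E * (first b m k w)%:E)%E).
    exact: integrableZl.
  have : (\int[P]_w c'%:E <= \int[P]_w ((csum b 0 weight0 m k w)%:E +
      (1 + c' / m%:R)%:E * (first b m k w)%:E))%E.
    apply: le_integral => //.
    + exact: finite_measure_integrable_cst.
    + exact: integrableD.
    + move=> w _; rewrite -EFinM -EFinD lee_fin.
      have fge0 := mean_drawdown_fun_ge0 mu sigma0.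
      exact: (first_time_lower_bound (X w) (mean_drawdown_fun0 mu sigma 0) c'0 k b0 m0 fge0 fc).
  rewrite integral_cst//= probability_setT mule1 integralD//.
  rewrite (compensated_sum_centered x0 BW (mesh_gt0 k) b0 weight01 hC') add0e integralZl//.
  have := integrable_fin_num measurableT iT.
  case: (\int[P]_w (first b m k w)%:E)%E => // r _.
  by rewrite -EFinM !lee_fin ler_pdivrMr// mulrC.
- apply: filterS continuous_paths => w cw.
  exact: first_time_le_drawdown_time1.
Qed.

Let oscillation eta m k := \bigcup_(j in `I_(m * k.+1)) [set w | eta < `|xi k w j|].

Let measurable_oscillation eta m k : measurable (oscillation eta m k).
Proof.
apply: bigcup_measurable => j _.
rewrite (_ : [set w | _] = ~` [set w | `|xi k w j| <= eta]); last first.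
  by apply/seteqP; split => w /=; rewrite ltNge => /negP.
apply: measurableC; rewrite -[X in measurable X]setTI; apply: measurable_fun_le => //.
by apply: measurableT_comp => //; exact: measurable_grid_increment.
Qed.

(** On a continuous path the event occurs for only finitely many [k], so its upper limit is
    negligible and the probability of the tail unions tends to 0. *)
Let oscillation_small eta m rho : 0 < eta -> 0 < rho ->
  exists k, (P (oscillation eta m k) <= rho%:E)%E.
Proof.
move=> eta0 rho0.
have lim0 : P (lim_sup_set (oscillation eta m)) = 0%E.
  apply/negligibleP.
    by apply: bigcap_measurableType => // n _; exact: bigcup_measurable.
  have [N [mN N0 HN]] := continuous_paths; exists N; split => //.
  move=> w wlim; apply: HN => /= cw.
  have [K KP] := grid_increment_small cw m eta0.
  have [k /= Kk [j /= jm]] := wlim K I.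
  by rewrite ltNge KP.
have Poo : (P (\bigcup_(k >= 0) oscillation eta m k) < +oo)%E.
  by rewrite (le_lt_trans (probability_le1 _ _)) ?ltry//; exact: bigcup_measurable.
have : P (\bigcup_(k >= n) oscillation eta m k) @[n --> \oo] --> (0%:E : \bar R).
  rewrite -[0%:E]lim0.
  exact: lim_sup_set_cvg P (oscillation eta m) (measurable_oscillation eta m) Poo.
move=> /fine_cvgP[_ /cvgrPdist_le/(_ _ rho0)[n _ /(_ n (leqnn n))]] /=.
rewrite sub0r normrN ger0_norm ?fine_ge0// => h; exists n.
have mU : measurable (\bigcup_(k >= n) oscillation eta m k) by exact: bigcup_measurable.
rewrite (@le_trans _ _ (P (\bigcup_(k >= n) oscillation eta m k)))//.
  by apply: le_measure; rewrite ?inE//; apply: bigcup_sup => /=.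
by rewrite -(fineK (fin_num_measure P _ mU)) lee_fin.
Qed.

Let mean_tau1_le_bound (c' : R) : c < c' -> (\int[P]_w tau w 1 <= c'%:E)%E.
Proof.
move=> cc'; have c'0 : 0 < c' by exact: lt_trans cc'.
have [delta [eta [eta0 fle0 fc]]] := mean_drawdown_fun_upper sigma0 a0 cc'.
have [C hC] := mean_drawdown_fun_normal mu sigma0 delta a.
apply: ge0_integral_le_bounded => // g m mg gm gtau.
(* Off the oscillation event [g <= c' - S]. On it only [g <= m%:R] is known and [S] has no pointwise
   bound, but [S <= e * S ^+ 2 + e^-1 / 4], so adding [e * S ^+ 2] everywhere and [e^-1 + m%:R] on
   the event restores the inequality. *)
have main (e : R) k : 0 < e -> (\int[P]_w (g w)%:E <= (c' + e * (m%:R * `|C|))%:E +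
    (e^-1 + m%:R)%:E * P (oscillation eta m k))%E.
  move=> e0.
  have hC' y (yb : 0 <= y <= a) := hC (mesh k) y (introT andP (conj (mesh_gt0 k) (mesh_le1 k))) yb.
  set S := csum a delta weight0 m k.
  have mS : measurable_fun setT S by exact: measurable_compensated_sum.
  have S2 : (\int[P]_w (S w ^+ 2)%:E <= (m%:R * `|C|)%:E)%E by exact: csum_sqr.
  have iS2 := integrable_sqr_le mS S2.
  have iS : P.-integrable setT (fun w => (S w)%:E) := integrable_of_sqr mS iS2.
  have iO : P.-integrable setT (fun w => (\1_(oscillation eta m k) w : R)%:E).
    by apply: integrable_indic => //; rewrite (le_lt_trans (probability_le1 _ _)) ?ltry.
  have iSe : P.-integrable setT (fun w => (e%:E * (S w ^+ 2)%:E)%E) by exact: integrableZl.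
  have iOe : P.-integrable setT
      (fun w => ((e^-1 + m%:R)%:E * (\1_(oscillation eta m k) w : R)%:E)%E).
    exact: integrableZl.
  have ic : P.-integrable setT (fun w : T => c'%:E) by exact: finite_measure_integrable_cst.
  have icS : P.-integrable setT (fun w => (c'%:E - (S w)%:E)%E) by exact: integrableB.
  have icSe : P.-integrable setT (fun w => (c'%:E - (S w)%:E + e%:E * (S w ^+ 2)%:E)%E).
    exact: integrableD.
  have ig : P.-integrable setT (fun w => (g w)%:E).
    apply: measurable_bounded_integrable => //.
    + by rewrite (le_lt_trans (probability_le1 _ _))// ltry.
    + exists m%:R; split; first exact: num_real.
      move=> y my w _ /=; have /andP[t0 t1] := gm w.
      by rewrite ger0_norm// (le_trans t1)// ltW.
  apply: (@le_trans _ _ (\int[P]_w (c'%:E - (S w)%:E + e%:E * (S w ^+ 2)%:E +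
      (e^-1 + m%:R)%:E * (\1_(oscillation eta m k) w : R)%:E))%E).
    apply: le_integral => //; first exact: integrableD.
    move=> w _; rewrite -!EFinM -EFinB -!EFinD lee_fin indicE.
    have /andP[g0 g1] := gm w.
    have gfirst : g w <= first a m k w.
      exact: drawdown_time1_le_grid (gtau w) g1.
    have eS : 0 <= e * S w ^+ 2 by rewrite mulr_ge0 ?sqr_ge0// ltW.
    have [_|wO] := boolP (w \in oscillation eta m k).
      have ei : 0 < e^-1 by rewrite invr_gt0.
      have : 0 <= e * (S w - e^-1 / 2) ^+ 2 by rewrite mulr_ge0 ?sqr_ge0// ltW.
      rewrite (_ : e * (S w - e^-1 / 2) ^+ 2 = e * S w ^+ 2 - S w + e^-1 / 4); last first.
        by field; rewrite gt_eqF.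
      by rewrite mulr1; lra.
    have xik j : (j < m * k.+1)%N -> `|xi k w j| <= eta.
      move=> jm; rewrite leNgt; apply/negP => H; move: wO; rewrite notin_setE; apply.
      by exists j.
    have := first_time_upper_bound (mean_drawdown_fun0 mu sigma delta) a0 eta0 fle0 fc xik.
    rewrite -/(first a m k w) -/(S w) mulr0 addr0 => h.
    by rewrite (le_trans gfirst)// (le_trans h)// lerDl.
  rewrite integralD// integralD// integralB// integralZl// integralZl//.
  rewrite integral_indic// setIT integral_cst//= probability_setT mule1.
  rewrite (compensated_sum_centered x0 BW (mesh_gt0 k) a0 weight01 hC') sube0 leeD2r//.
  rewrite EFinD leeD2l// EFinM; apply: lee_wpmul2l => //.
  by rewrite lee_fin ltW.
have ig0 : (0 <= \int[P]_w (g w)%:E)%E.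
  by apply: integral_ge0 => w _; rewrite lee_fin; have /andP[] := gm w.
have igm : (\int[P]_w (g w)%:E <= m%:R%:E)%E.
  rewrite -[leRHS]mule1 -(@probability_setT _ _ _ P) -integral_cst//.
  apply: ge0_le_integral => //.
  - by move=> w _; rewrite lee_fin; have /andP[] := gm w.
  - exact/measurable_EFinP.
  - by move=> w _; rewrite lee_fin; have /andP[] := gm w.
move: main ig0 igm; case: (\int[P]_w (g w)%:E)%E => // r main _ _.
rewrite lee_fin leNgt; apply/negP => c'r.
pose gap := r - c'; have gap0 : 0 < gap by rewrite subr_gt0.
have D0 : 0 <= m%:R * `|C| by rewrite mulr_ge0.
(* First [e] makes the quadratic term at most [gap / 4]; the mesh is then taken so fine that the
   oscillation term, with this [e], is at most [gap / 4] too. *)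
pose e := gap / (4 * (m%:R * `|C| + 1)).
have e0 : 0 < e by rewrite divr_gt0// mulr_gt0// ltr_wpDl.
have eD : e * (m%:R * `|C|) <= gap / 4.
  rewrite /e; move: (m%:R * `|C|) D0 => D D0; have D1 : 0 < D + 1 by rewrite ltr_wpDl.
  have -> : gap / (4 * (D + 1)) * D = gap / 4 * (D / (D + 1)) by field; rewrite gt_eqF.
  by rewrite ler_piMr ?divr_ge0 ?(ltW gap0)// ler_pdivrMr// mul1r lerDl.
have em0 : 0 < e^-1 + m%:R by rewrite ltr_wpDr// invr_gt0.
pose rho := gap / 4 / (e^-1 + m%:R).
have rho0 : 0 < rho by rewrite divr_gt0// divr_gt0.
have [k Pk] := oscillation_small m eta0 rho0.
have := main e k e0.
have : ((e^-1 + m%:R)%:E * P (oscillation eta m k) <= (gap / 4)%:E)%E.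
  rewrite (_ : gap / 4 = (e^-1 + m%:R) * rho); last first.
    by rewrite /rho mulrCA divff ?gt_eqF// mulr1.
  by rewrite EFinM lee_wpmul2l// lee_fin ltW.
move=> /(leeD2l (c' + e * (m%:R * `|C|))%:E) h1 h2.
have := le_trans h2 h1; rewrite -EFinD lee_fin leNgt => /negP; apply.
rewrite [ltRHS](_ : r = c' + gap); last by rewrite /gap subrKC.
rewrite -addrA ltrD2l (le_lt_trans (lerD eD (lexx _)))//.
by rewrite -mulrDl ltr_pdivrMr// -[X in X < _]/(gap *+ 2) -(mulr_natr gap 2) ltr_pM2l// ltr_nat.
Qed.

Lemma mean_drawdown_time1 : (\int[P]_w tau w 1 = c%:E)%E.
Proof.
have I0 : (0 <= \int[P]_w tau w 1)%E by exact: integral_ge0.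
have Ile := mean_tau1_le_bound.
have Ige := mean_tau1_ge_bound.
have c1 : c < c + 1 by rewrite ltrDl.
have I1 := Ile _ c1.
move: I0 I1 Ile Ige; case: (\int[P]_w tau w 1)%E => // r r0 _ Ile Ige.
rewrite lee_fin in r0; congr EFin; apply/eqP; rewrite eq_le; apply/andP; split.
  by apply/ler_addgt0Pr => e e0; rewrite -lee_fin Ile// ltrDl.
rewrite leNgt; apply/negP => rc.
pose c' := (r + c) / 2.
have c'0 : 0 < c' by rewrite /c'; lra.
have c'c : c' < c by rewrite /c'; lra.
have rc' : r < c' by rewrite /c'; lra.
have gap : 0 < c' - r by rewrite subr_gt0.
(* The bound c' / (1 + c' / m) <= r means m (c' - r) <= r c', which this [m] violates. *)
pose m := (Num.truncn (r * c' / (c' - r))).+1.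
have m0 : 0 < m%:R :> R by rewrite ltr0n.
have mP : r * c' < m%:R * (c' - r) by rewrite -ltr_pdivrMr// truncnS_gt.
have := Ige c' m c'0 c'c isT; rewrite lee_fin ler_pdivrMr; last first.
  by rewrite ltr_wpDr// divr_ge0// ltW.
rewrite mulrDr mulr1 mulrA -lerBlDl ler_pdivlMr// => h.
by move: mP; rewrite [m%:R * _]mulrC ltNge h.
Qed.

End brownian_drawdowns.

Theorem mainTheorem5 (R : realType) (d : measure_display)
    (T : measurableType d) (P : probability T R) (W : R -> {RV P >-> R})
    (x0 mu sigma a : R) :
  standard_brownian_motion W -> 0 < sigma -> 0 < a ->
  let X (w : T) : R -> R := drifted_path x0 mu sigma (fun t => W t w) in
  let Etau1 : \bar R := (\int[P]_w drawdown_time a (X w) 1)%E in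
  [/\ {ae P, forall w,
        (drawdown_count a (X w) t / t%:E)%E @[t --> +oo] --> (Etau1^-1)%E},
      (Etau1^-1)%E = (drawdown_rate sigma a mu)%:E
    & drawdown_rate_formula sigma a m @[m --> 0^'] --> sigma ^+ 2 / a ^+ 2].
Proof.
move=> BW sigma0 a0 X Etau1.
have EE : Etau1 = (mean_drawdown_fun mu sigma 0 a)%:E by exact: mean_drawdown_time1.
have Einv : (Etau1^-1)%E = ((mean_drawdown_fun mu sigma 0 a)^-1)%:E.
  by rewrite EE inver gt_eqF// mean_drawdown_fun_gt0.
split.
- by rewrite Einv; exact: drawdown_count_cvg_ae.
- by rewrite Einv mean_drawdown_fun_rate.
- exact: drawdown_rate_formula_cvg.
Qed.
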